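(* Let $\Sigma_1\subset\mathbf P^5$ be the intersection of three quadrics of the context. (1) The lines on $\Sigma_1$ are exactly the following four, where for each line only the equations of a plane $\Pi$ are given such that $\Pi\cap\Sigma_1$ is the (double) line in question: $$\widetilde\Theta_1:\ Y_1=\sqrt{b_1}X_2+\sqrt{b_2}X_3=\sqrt{b_2}Y_2+\sqrt{b_1}Y_3=0,$$ $$\widetilde\Theta_2:\ X_1=\sqrt{b_3}X_2+\sqrt{b_4}Y_3=\sqrt{b_3}X_3+\sqrt{b_4}Y_2=0,$$ $$E_1:\ X_1=\sqrt{b_1}X_2+\sqrt{b_2}X_3=\sqrt{b_2}Y_2+\sqrt{b_1}Y_3=0,$$ $$E_2:\ Y_1=\sqrt{b_3}X_2+\sqrt{b_4}Y_3=\sqrt{b_3}X_3+\sqrt{b_4}Y_2=0.$$ The dual graph of the four lines is a square, that is, $\widetilde\Theta_1\cdot\widetilde\Theta_2=E_1\cdot E_2=0$ and $\widetilde\Theta_i\cdot E_j=1$ for $1\le i,j\le2$. (2) The surface $\Sigma_1$ has exactly four singular points, which are the intersection points of the four lines.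
   Context: $k$ is an algebraically closed field of characteristic $2$ (square roots are unique); $(X_1,X_2,X_3,Y_1,Y_2,Y_3)$ are homogeneous coordinates on $\mathbf P^5$. The constants $a_1,a_2,a_3,c_i,d_i,b_1,\dots,b_4\in k$ satisfy: $a_1\neq a_2=a_3$; $b_1=\beta_3\gamma_2$, $b_2=\alpha_2\delta_3$, $b_3=\gamma_2\delta_3$, $b_4=\alpha_2\beta_3$ for some $\alpha_i,\beta_i,\gamma_i,\delta_i\in k$ with $\alpha_i\delta_i+\beta_i\gamma_i=1$ (so $b_1b_2=b_3b_4$); and $c_1d_1\neq0$, $b_2b_4c_2+b_1b_4c_3+b_1b_3d_2+b_2b_3d_3\neq0$ (the condition for the quadratic line complex $\mathcal X_1$ defined by the first two equations below to be non-singular). $\Sigma_1$ is the surface (the set of singular lines of $\mathcal X_1$) defined by $$\sum_{i=1}^3X_iY_i=0,$$ $$\sum_{i=1}^3(a_iX_iY_i+c_iX_i^2+d_iY_i^2)+b_1X_2Y_3+b_2X_3Y_2+b_3X_2X_3+b_4Y_2Y_3=0,$$ $$\sum_{i=1}^3a_i^2X_iY_i+b_1b_3X_2^2+b_2b_3X_3^2+b_2b_4Y_2^2+b_1b_4Y_3^2=0.$$ For two of the lines, the symbol $\ell\cdot m=0$ means they are disjoint and $\ell\cdot m=1$ means they meet in one point. *)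

(* Defs.v *)
From HB Require Import structures.
From mathcomp Require Import all_boot all_order all_algebra.
From mathcomp Require Export mpoly.

Set Implicit Arguments.
Unset Strict Implicit.
Unset Printing Implicit Defensive.

Import GRing.Theory.
Local Open Scope ring_scope.

Section SquareRoot.
Variable k : closedFieldType.

Lemma sqrt_ex (x : k) : exists y : k, y ^+ 2 == x.
Proof.
have /closed_rootP[y] : size ('X^2 - x%:P : {poly k}) != 1%N by rewrite size_XnsubC.
by rewrite rootE !hornerE subr_eq0; exists y.
Qed.

Definition ksqrt (x : k) : k := xchoose (sqrt_ex x).

Lemma ksqrtK (x : k) : ksqrt x ^+ 2 = x.
Proof. exact/eqP/(xchooseP (sqrt_ex x)). Qed.

(* In characteristic 2 the square root is unique, so that the choice made by
   ksqrt is immaterial. *)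
Lemma ksqrt_unique (x y : k) : 2%N \in [pchar k] -> y ^+ 2 = x -> ksqrt x = y.
Proof.
move=> ch2 yx; apply/eqP; have /eqP := ksqrtK x.
by rewrite -yx -!(pFrobenius_autE ch2) (inj_eq (fmorph_inj (pFrobenius_aut ch2))).
Qed.
End SquareRoot.

(* Linear subspaces of P^(n-1) are encoded as vector subspaces of k^n: a point,
   a line, a plane is a subspace of dimension 1, 2, 3 respectively, and the
   empty set is the zero subspace.  Closed subschemes of P^(n-1) are given by
   lists of homogeneous polynomials. *)
Section Projective.
Variables (k : fieldType) (n : nat).
Implicit Types (U V p L : {vspace 'rV[k]_n}) (fs gs ls : seq {mpoly k[n]}).

Definition evalv (f : {mpoly k[n]}) (v : 'rV[k]_n) : k := f.@[fun i => v 0 i].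

Definition common_zero fs (v : 'rV[k]_n) : bool :=
  all (fun f => evalv f v == 0) fs.

Definition contained U fs : Prop := forall v, v \in U -> common_zero fs v.

Definition zero_locus_is fs U : Prop := forall v, (v \in U) = common_zero fs v.

Definition in_ideal fs (f : {mpoly k[n]}) : Prop :=
  exists h : nat -> {mpoly k[n]}, f = \sum_(i < size fs) h i * fs`_i.

(* Saturation with respect to the irrelevant ideal. *)
Definition in_saturation fs (f : {mpoly k[n]}) : Prop :=
  exists N : nat, forall i : 'I_n, in_ideal fs ('X_i ^+ N * f).

Definition same_subscheme fs gs : Prop :=
  forall f, in_saturation fs f <-> in_saturation gs f.

(* The linear forms ls define a plane, and the scheme-theoretic intersection of
   this plane with the subscheme defined by fs is the line L counted twice: L
   is cut out in the plane by a linear form m, and the intersection is the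
   subscheme of the plane defined by m ^+ 2. *)
Definition plane_cuts_double_line fs ls L : Prop :=
  (exists2 P : {vspace 'rV[k]_n}, zero_locus_is ls P & (\dim P = 3)%N) /\
  (\dim L = 2)%N /\
  exists m : {mpoly k[n]},
    [/\ m \is 1.-homog, zero_locus_is (m :: ls) L
      & same_subscheme (ls ++ fs) (m ^+ 2 :: ls)].

Definition jacobian fs (v : 'rV[k]_n) : 'M[k]_(size fs, n) :=
  \matrix_(i < size fs, j < n) evalv (mderiv j fs`_i) v.

(* Singular points of an intersection of hypersurfaces whose codimension is the
   number of equations: the Zariski tangent space at the point, which is the
   projective space of the kernel of the Jacobian matrix, is of dimension
   greater than that of the intersection. *)
Definition singular_point fs p : Prop :=
  [/\ (\dim p = 1)%N, contained p fs
    & forall v, v \in p -> v != 0 -> (\rank (jacobian fs v) < size fs)%N].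
End Projective.

Definition i1 : 'I_3 := @Ordinal 3 0 isT.
Definition i2 : 'I_3 := @Ordinal 3 1 isT.
Definition i3 : 'I_3 := @Ordinal 3 2 isT.

Section Surface.
Variable k : closedFieldType.

(* Homogeneous coordinates (X_1, X_2, X_3, Y_1, Y_2, Y_3) on P^5. *)
Definition X (i : 'I_3) : {mpoly k[3 + 3]} := 'X_(lshift 3 i).
Definition Y (i : 'I_3) : {mpoly k[3 + 3]} := 'X_(rshift 3 i).

Variables (a c d : 'I_3 -> k) (b1 b2 b3 b4 : k).

Definition quadric1 : {mpoly k[3 + 3]} := \sum_(i < 3) X i * Y i.

Definition quadric2 : {mpoly k[3 + 3]} :=
  \sum_(i < 3) (a i *: (X i * Y i) + c i *: X i ^+ 2 + d i *: Y i ^+ 2)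
  + b1 *: (X i2 * Y i3) + b2 *: (X i3 * Y i2)
  + b3 *: (X i2 * X i3) + b4 *: (Y i2 * Y i3).

Definition quadric3 : {mpoly k[3 + 3]} :=
  \sum_(i < 3) a i ^+ 2 *: (X i * Y i)
  + (b1 * b3) *: X i2 ^+ 2 + (b2 * b3) *: X i3 ^+ 2
  + (b2 * b4) *: Y i2 ^+ 2 + (b1 * b4) *: Y i3 ^+ 2.

Definition Sigma1 : seq {mpoly k[3 + 3]} := [:: quadric1; quadric2; quadric3].

Definition plane_Theta1 : seq {mpoly k[3 + 3]} :=
  [:: Y i1; ksqrt b1 *: X i2 + ksqrt b2 *: X i3;
      ksqrt b2 *: Y i2 + ksqrt b1 *: Y i3].

Definition plane_Theta2 : seq {mpoly k[3 + 3]} :=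
  [:: X i1; ksqrt b3 *: X i2 + ksqrt b4 *: Y i3;
      ksqrt b3 *: X i3 + ksqrt b4 *: Y i2].

Definition plane_E1 : seq {mpoly k[3 + 3]} :=
  [:: X i1; ksqrt b1 *: X i2 + ksqrt b2 *: X i3;
      ksqrt b2 *: Y i2 + ksqrt b1 *: Y i3].

Definition plane_E2 : seq {mpoly k[3 + 3]} :=
  [:: Y i1; ksqrt b3 *: X i2 + ksqrt b4 *: Y i3;
      ksqrt b3 *: X i3 + ksqrt b4 *: Y i2].
End Surface.

(* Main.v *)
(** Write [b1, b2, b3, b4] as the squares of [q r], [p t], [q t], [p r], and put
    [A = q^2 X2 + p^2 Y2], [B = t^2 X3 + r^2 Y3], [M = r t A + p q B] and
    [N = sum (sqrt c_i X_i + sqrt d_i Y_i)].  In characteristic 2, subtracting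
    multiples of the first equation turns the other two into
    [e X1 Y1 + N^2 + A B] and [e^2 X1 Y1 + M^2], where [e = a1 + a2 != 0].

    Let [F1 = q r X2 + p t X3], [F2 = p t Y2 + q r Y3], [G1 = q t X2 + p r Y3],
    [G2 = q t X3 + p r Y2].  All products [Fi Gj] lie in the ideal
    [(M, X2 Y2 + X3 Y3)], so a point of the surface with [X1 Y1 = 0] lies on
    [F1 = F2 = 0] or on [G1 = G2 = 0]: this gives the four lines.  On a line of
    the surface, [X1] and [Y1] are proportional since [e^2 X1 Y1] is a square, so
    there is a point with [X1 = Y1 = 0]; if [X1 Y1] did not vanish on the line,
    polarity would force [A = B = 0] at that point, hence [F1 = F2 = G1 = G2 = N = 0], and
    non-singularity of the complex excludes such a point.  The Jacobian matrix
    drops rank exactly where [X1 = Y1 = 0] or [A = B = 0]. *)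

Require Import Defs.
From mathcomp Require Import all_boot all_order all_algebra mpoly ring zify.

Set Implicit Arguments.
Unset Strict Implicit.
Unset Printing Implicit Defensive.

Import GRing.Theory.
Local Open Scope ring_scope.

(** * Linear forms and ideals *)

Section LinearForms.
Variables (k : fieldType) (n : nat).
Implicit Types (f g : {mpoly k[n]}) (fs gs ls : seq {mpoly k[n]}).
Implicit Types (U V L : {vspace 'rV[k]_n}) (u v : 'rV[k]_n).

Lemma evalvD f g v : evalv (f + g) v = evalv f v + evalv g v.
Proof. exact: mevalD. Qed.

Lemma evalvM f g v : evalv (f * g) v = evalv f v * evalv g v.
Proof. exact: mevalM. Qed.

Lemma evalvZ a f v : evalv (a *: f) v = a * evalv f v.
Proof. exact: mevalZ. Qed.

Lemma evalvXn f m v : evalv (f ^+ m) v = evalv f v ^+ m.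
Proof. exact: rmorphXn. Qed.

Lemma evalv_var i v : evalv 'X_i v = v 0 i.
Proof. exact: mevalXU. Qed.

Definition evalvE := (evalvD, evalvM, evalvZ, evalvXn, evalv_var).

Lemma var_homog1 (i : 'I_n) : ('X_i : {mpoly k[n]}) \is 1.-homog.
Proof. by rewrite dhomogX; apply/eqP; exact: mdeg1. Qed.

Lemma evalv_linear f : f \is 1.-homog ->
  forall a u v, evalv f (a *: u + v) = a * evalv f u + evalv f v.
Proof.
move=> /dhomogP hf a u v; rewrite /evalv !mevalE mulr_sumr -big_split /=.
apply: eq_big_seq => m /hf/eqP/mdeg1P[i /eqP ->].
have E w : \prod_(j < n) w 0 j ^+ U_(i)%MM j = w 0 i :> k.
  rewrite (bigD1 i) //= mnm1E eqxx expr1 big1 ?mulr1 // => j ji.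
  by rewrite mnm1E eq_sym (negPf ji).
by rewrite !E !mxE; ring.
Qed.

Lemma linear_form_mxE f : f \is 1.-homog -> forall v,
  evalv f v = (v *m \col_i evalv f (delta_mx 0 i)) 0 0.
Proof.
move=> hf v; rewrite {1}[v]row_sum_delta mxE.
have f0 : evalv f 0 = 0.
  by have := evalv_linear hf (-1) 0 0; rewrite scaler0 addr0 mulN1r addNr.
rewrite (big_morph (evalv f) (id1 := 0) (op1 := +%R)) //; last first.
  by move=> u w; have := evalv_linear hf 1 u w; rewrite scale1r mul1r.
apply: eq_bigr => i _; rewrite mxE -[X in evalv f X]addr0 evalv_linear //.
by rewrite f0 addr0.
Qed.

(** The locus is the kernel of right multiplication by the coefficient matrix, whose image has
    dimension at most the number of forms. *)
Lemma zero_locus_exists ls : {in ls, forall f, f \is 1.-homog} ->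
  exists2 U, zero_locus_is ls U & (n <= \dim U + size ls)%N.
Proof.
move=> hls; pose C := \matrix_(i < n, j < size ls) evalv ls`_j (delta_mx 0 i).
pose phi := linfun (mulmxr C : 'rV[k]_n -> 'rV[k]_(size ls)).
exists (lker phi) => [v|].
  rewrite memv_ker lfunE /=; apply/eqP/allP => [vC f /(nthP 0)[i ils <-]|ls0].
    rewrite linear_form_mxE ?hls ?mem_nth //.
    have /rowP/(_ (Ordinal ils)) := vC; rewrite mxE [RHS]mxE => <-; apply/eqP.
    by rewrite mxE; apply: eq_bigr => j _; rewrite !mxE.
  apply/rowP => j; have /eqP := ls0 _ (mem_nth 0 (ltn_ord j)).
  rewrite linear_form_mxE ?hls ?mem_nth // => E.
  rewrite mxE [RHS]mxE -[RHS]E [RHS]mxE.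
  by apply: eq_bigr => i _; rewrite !mxE.
have := limg_ker_dim phi fullv; rewrite capfv dimvf /dim /= mul1n => E.
rewrite -{1}E leq_add2l; apply: leq_trans (dimvS (subvf _)) _.
by rewrite dimvf /dim /= mul1n.
Qed.

(** The complementary forms replace a proof of linear independence: both loci have at least the
    expected dimension, and their trivial intersection forces equality. *)
Lemma zero_locus_dim ls ls' : {in ls ++ ls', forall f, f \is 1.-homog} ->
    (size ls + size ls' = n)%N ->
    (forall v, common_zero (ls ++ ls') v -> v = 0) ->
  exists2 U, zero_locus_is ls U & \dim U = size ls'.
Proof.
move=> hl sz triv.
have [|U UE dU] := @zero_locus_exists ls.
  by move=> f fl; apply: hl; rewrite mem_cat fl.
have [|U' UE' dU'] := @zero_locus_exists ls'.
  by move=> f fl; apply: hl; rewrite mem_cat fl orbT.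
exists U => //; have UU0 : (U :&: U' = 0)%VS.
  apply/eqP; rewrite -subv0; apply/subvP => v; rewrite memv_cap memv0 UE UE'.
  by rewrite -all_cat => /triv ->.
have := dimvS (subvf (U + U')%VS); rewrite dimvf /dim /= mul1n.
by rewrite dimv_disjoint_sum //; lia.
Qed.

(** A hyperplane cannot miss a subspace of dimension at least two. *)
Lemma form_vanishes_somewhere L f : (1 < \dim L)%N -> f \is 1.-homog ->
  exists v, [/\ v \in L, v != 0 & evalv f v = 0].
Proof.
move=> dL hf; have [|U UE dU] := @zero_locus_exists [:: f].
  by move=> g; rewrite inE => /eqP ->.
have LU0 : (L :&: U != 0)%VS.
  apply/negP => /eqP LU0; have := dimvS (subvf (L + U)%VS).
  rewrite dimv_disjoint_sum // dimvf /dim /= mul1n leqNgt => /negP[].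
  by apply: leq_ltn_trans dU _; rewrite /= addnC ltn_add2r.
exists (vpick (L :&: U)); have := memv_pick (L :&: U).
rewrite memv_cap UE /common_zero /= andbT => /andP[-> /eqP ->].
by rewrite vpick0.
Qed.

End LinearForms.

Section Ideals.
Variables (k : fieldType) (n : nat).
Implicit Types (f g h : {mpoly k[n]}) (fs gs ls : seq {mpoly k[n]}).

Lemma in_ideal_cons g gs f :
  in_ideal (g :: gs) f <-> exists a h, in_ideal gs h /\ f = a * g + h.
Proof.
split=> [[c ->]|[a [_ [[c ->] ->]]]].
  rewrite big_ord_recl /=; do 2!eexists; split; last by [].
  by exists (fun i => c i.+1).
by exists (fun i => if i is j.+1 then c j else a); rewrite big_ord_recl.
Qed.

Lemma in_ideal0 fs : in_ideal fs 0.
Proof. by exists (fun=> 0); rewrite big1 // => i _; rewrite mul0r. Qed.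

Lemma in_idealD fs f g : in_ideal fs f -> in_ideal fs g -> in_ideal fs (f + g).
Proof.
move=> [a ->] [b ->]; exists (fun i => a i + b i).
by rewrite -big_split; apply: eq_bigr => i _; rewrite mulrDl.
Qed.

Lemma in_idealMl fs h f : in_ideal fs f -> in_ideal fs (h * f).
Proof.
move=> [a ->]; exists (fun i => h * a i).
by rewrite mulr_sumr; apply: eq_bigr => i _; rewrite mulrA.
Qed.

Lemma in_idealZ fs a f : in_ideal fs f -> in_ideal fs (a *: f).
Proof. by rewrite -mul_mpolyC; exact: in_idealMl. Qed.

Lemma in_ideal_trans fs gs f :
  {in fs, forall g, in_ideal gs g} -> in_ideal fs f -> in_ideal gs f.
Proof.
move=> fsgs [h ->]; elim/big_ind: _ => [|f1 f2|i _]; first exact: in_ideal0.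
  exact: in_idealD.
exact/in_idealMl/fsgs/mem_nth.
Qed.

Lemma in_ideal_mem fs f : f \in fs -> in_ideal fs f.
Proof.
elim: fs => //= g fs IH; rewrite inE => /predU1P[->|/IH fsf].
  apply/in_ideal_cons; exists 1, 0; split; first exact: in_ideal0.
  by rewrite mul1r addr0.
by apply/in_ideal_cons; exists 0, f; split; rewrite // mul0r add0r.
Qed.

(** Both lists generate the same ideal, so the exponent of the saturation carries over unchanged. *)
Lemma same_subscheme_gens fs gs :
    {in fs, forall f, in_ideal gs f} -> {in gs, forall f, in_ideal fs f} ->
  same_subscheme fs gs.
Proof.
move=> fg gf f; split=> -[N h]; exists N => i.
  exact: in_ideal_trans (h i).
exact: in_ideal_trans (h i).
Qed.

End Ideals.

(** * Double lines *)

Section Characteristic2.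
Variables (R : nzRingType) (char2 : 2%N \in [pchar R]).

Lemma char2_2 : 2 = 0 :> R. Proof. exact: pcharf0. Qed.
Lemma char2_3 : 3 = 1 :> R. Proof. by rewrite (natrD _ 2 1) char2_2 add0r. Qed.
Lemma char2_4 : 4 = 0 :> R. Proof. by rewrite (natrD _ 2 2) char2_2 addr0. Qed.

Lemma char2_addr_eq0 (x y : R) : (x + y == 0) = (x == y).
Proof. by rewrite -[RHS]subr_eq0 oppr_pchar2. Qed.

End Characteristic2.

(* [ring] with hypotheses rewrites a coefficient only when it is literally the
   left-hand side of one of them. *)
Ltac char2_ring H := rewrite -?mul_mpolyC; ring: (char2_2 H) (char2_3 H) (char2_4 H).

Lemma sqr_add_char2 (R : comNzRingType) (x y : R) :
  2%N \in [pchar R] -> (x + y) ^+ 2 = x ^+ 2 + y ^+ 2.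
Proof. by move=> h; char2_ring h. Qed.

(** Lets later arguments multiply by [s * a + w * b] instead of splitting on which of [a] and [b] is
    nonzero. *)
Lemma normalized_pair (k : fieldType) (a b : k) : (a != 0) || (b != 0) ->
  exists s w, s * a + w * b = 1.
Proof.
case/orP=> h; [exists a^-1, 0 | exists 0, b^-1].
  by rewrite mulVf // mul0r addr0.
by rewrite mulVf // mul0r add0r.
Qed.

Lemma cancel_pair (k : fieldType) (a b x : k) :
  (a != 0) || (b != 0) -> a * x = 0 -> b * x = 0 -> x = 0.
Proof.
by move=> /orP[] h ax bx; apply: (mulfI h); rewrite mulr0.
Qed.

Section DoubleLine.
Variables (k : closedFieldType) (char2 : 2%N \in [pchar k]).
(** The coordinates are abstract so that one lemma serves all four planes, after exchanging X1 with
    Y1 or X3 with Y3. [coord0] expresses that the six indices exhaust the coordinates. *)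
Variables (z z' x2 x3 y2 y3 : 'I_(3 + 3)).
Hypothesis coord0 : forall v : 'rV[k]_(3 + 3),
  v 0 z = 0 -> v 0 z' = 0 -> v 0 x2 = 0 -> v 0 x3 = 0 -> v 0 y2 = 0 ->
  v 0 y3 = 0 -> v = 0.
Variables (p q r t c e c' e' nz : k) (N : {mpoly k[3 + 3]}).
Hypotheses (N_homog : N \is 1.-homog) (nz0 : nz != 0).
Hypothesis N_z : forall v : 'rV[k]_(3 + 3),
  v 0 z' = 0 -> v 0 x2 = 0 -> v 0 x3 = 0 -> v 0 y2 = 0 -> v 0 y3 = 0 ->
  evalv N v = nz * v 0 z.
Hypothesis ptqr : (p * t != 0) || (q * r != 0).

Let Q1 : {mpoly k[3 + 3]} := 'X_z * 'X_z' + 'X_x2 * 'X_y2 + 'X_x3 * 'X_y3.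
Let A : {mpoly k[3 + 3]} := q ^+ 2 *: 'X_x2 + p ^+ 2 *: 'X_y2.
Let B : {mpoly k[3 + 3]} := t ^+ 2 *: 'X_x3 + r ^+ 2 *: 'X_y3.
Let Q2 := c *: Q1 + e *: ('X_z * 'X_z') + N ^+ 2 + A * B.
Let Q3 :=
  c' *: Q1 + e' *: ('X_z * 'X_z') + ((r * t) *: A + (p * q) *: B) ^+ 2.
Let F1 : {mpoly k[3 + 3]} := (q * r) *: 'X_x2 + (p * t) *: 'X_x3.
Let F2 : {mpoly k[3 + 3]} := (p * t) *: 'X_y2 + (q * r) *: 'X_y3.
Let ls := [:: 'X_z'; F1; F2].

(* The double line is cut out in the plane by [N + sqrt (p q r t) H], where [H]
   is the linear form whose multiples are the restrictions of [A] and [B]. *)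
Lemma plane_section_double_line :
  exists L, plane_cuts_double_line [:: Q1; Q2; Q3] ls L /\
    forall v, (v \in L) = [&& v 0 z' == 0, evalv F1 v == 0, evalv F2 v == 0
      & evalv N v ^+ 2 + evalv A v * evalv B v == 0].
Proof.
have mchar2 : 2%N \in [pchar {mpoly k[3 + 3]}].
  exact: (rmorph_pchar (mpolyC (3 + 3) (R := k)) char2).
have [s [w sw]] := normalized_pair ptqr.
have [g gE] : exists g, g ^+ 2 = p * q * r * t.
  by exists (ksqrt (p * q * r * t)); rewrite ksqrtK.
(* By [sw], in characteristic 2, [(F1, U)] and [(F2, W)] are unimodular changes of the coordinates
   [(x2, x3)] and [(y2, y3)]; on the plane, [z], [U] and [W] remain as coordinates. *)
pose U : {mpoly k[3 + 3]} := s *: 'X_x2 + w *: 'X_x3.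
pose W : {mpoly k[3 + 3]} := w *: 'X_y2 + s *: 'X_y3.
pose H := (q * t) *: U + (p * r) *: W; pose m := N + g *: H.
pose M := (q * t) *: F1 + (p * r) *: F2.
have Q1E : Q1 = 'X_z * 'X_z' + U * F2 + W * F1.
  transitivity ('X_z * 'X_z'
      + (s * (p * t) + w * (q * r)) *: ('X_x2 * 'X_y2 + 'X_x3 * 'X_y3)).
    by rewrite sw scale1r addrA.
  by rewrite /U /W /F1 /F2; char2_ring mchar2.
have ME : (r * t) *: A + (p * q) *: B = M.
  by rewrite /M /A /B /F1 /F2; char2_ring mchar2.
(* A B equals G1 G2 modulo F1, and modulo [M] the factors G1 and G2 are p t H and q r H; hence A B
   restricts to a scalar times a square. *)
have ABE : A * B = (p * q * r * t) *: H ^+ 2 + F1 * F2 + (H + (s * w) *: M) * M.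
  pose G1 : {mpoly k[3 + 3]} := (q * t) *: 'X_x2 + (p * r) *: 'X_y3.
  pose G2 : {mpoly k[3 + 3]} := (q * t) *: 'X_x3 + (p * r) *: 'X_y2.
  have -> : A * B = F1 * F2 + G1 * G2.
    by rewrite /A /B /F1 /F2 /G1 /G2; char2_ring mchar2.
  have -> : G1 = (p * t) *: H + w *: M.
    rewrite -[LHS]scale1r -sw /G1 /H /M /U /W /F1 /F2; char2_ring mchar2.
  have -> : G2 = (q * r) *: H + s *: M.
    rewrite -[LHS]scale1r -sw /G2 /H /M /U /W /F1 /F2; char2_ring mchar2.
  transitivity ((p * q * r * t) *: H ^+ 2 + F1 * F2
      + ((s * (p * t) + w * (q * r)) *: H + (s * w) *: M) * M).
    by char2_ring mchar2.
  by rewrite sw scale1r.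
(* A sum of two squares is a square, so the root [g] of p q r t merges N^2 with the remaining
   term. *)
have NE : N ^+ 2 + A * B = m ^+ 2 + (F1 * F2 + (H + (s * w) *: M) * M).
  have -> : m ^+ 2 = N ^+ 2 + (p * q * r * t) *: H ^+ 2.
    by rewrite -gE -exprZn -sqr_add_char2.
  by rewrite ABE !addrA.
have lsh : {in ls, forall f, f \is 1.-homog}.
  move=> f; rewrite !inE => /or3P[] /eqP ->.
  - exact: var_homog1.
  - by apply: dhomogD; apply: dhomogZ; apply: var_homog1.
  - by apply: dhomogD; apply: dhomogZ; apply: var_homog1.
have Uh : U \is 1.-homog.
  by apply: dhomogD; apply: dhomogZ; apply: var_homog1.
have Wh : W \is 1.-homog.
  by apply: dhomogD; apply: dhomogZ; apply: var_homog1.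
have mh : m \is 1.-homog.
  apply: dhomogD => //; apply: dhomogZ.
  by apply: dhomogD; apply: dhomogZ.
(* Stated for any list containing [ls], since both ideals to be compared contain these forms. *)
have ideal_ls fs : {subset ls <= fs} -> [/\ in_ideal fs ('X_z * 'X_z'),
    in_ideal fs Q1, in_ideal fs M & in_ideal fs (F1 * F2 + (H + (s * w) *: M) * M)].
  move=> sub; have i0 : in_ideal fs 'X_z'.
    by apply/in_ideal_mem/sub; rewrite mem_head.
  have i1 : in_ideal fs F1.
    by apply/in_ideal_mem/sub; rewrite !inE eqxx orbT.
  have i2 : in_ideal fs F2.
    by apply/in_ideal_mem/sub; rewrite !inE eqxx !orbT.
  have iM : in_ideal fs M by apply: in_idealD; apply: in_idealZ.
  split=> //; first exact: in_idealMl.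
    by rewrite Q1E; do ?apply: in_idealD; apply: in_idealMl.
  by apply: in_idealD; apply: in_idealMl.
have UW0 v : evalv F1 v = 0 -> evalv F2 v = 0 -> evalv U v = 0 ->
    evalv W v = 0 -> [/\ v 0 x2 = 0, v 0 x3 = 0, v 0 y2 = 0 & v 0 y3 = 0].
  rewrite /F1 /F2 /U /W !evalvE => f1 f2 u0 w0.
  split; rewrite -[LHS]mul1r -sw.
  - transitivity (p * t * (s * v 0 x2 + w * v 0 x3)
      + w * (q * r * v 0 x2 + p * t * v 0 x3)); first by char2_ring char2.
    by rewrite u0 f1 !mulr0 addr0.
  - transitivity (q * r * (s * v 0 x2 + w * v 0 x3)
      + s * (q * r * v 0 x2 + p * t * v 0 x3)); first by char2_ring char2.
    by rewrite u0 f1 !mulr0 addr0.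
  - transitivity (q * r * (w * v 0 y2 + s * v 0 y3)
      + s * (p * t * v 0 y2 + q * r * v 0 y3)); first by char2_ring char2.
    by rewrite w0 f2 !mulr0 addr0.
  - transitivity (p * t * (w * v 0 y2 + s * v 0 y3)
      + w * (p * t * v 0 y2 + q * r * v 0 y3)); first by char2_ring char2.
    by rewrite w0 f2 !mulr0 addr0.
(* The forms [z], [U], [W] complete [ls] to a system without nonzero solution, so the plane has
   dimension 3. *)
have [||v|P PE dP] := @zero_locus_dim _ _ ls [:: 'X_z; U; W].
- move=> f; rewrite mem_cat => /orP[/lsh //|].
  by rewrite !inE => /or3P[] /eqP -> //; apply: var_homog1.
- by [].
- rewrite /common_zero /= !evalv_var andbT.
  case/and5P=> /eqP vz' /eqP f1 /eqP f2 /eqP vz /andP[/eqP u0 /eqP w0].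
  by have [v2 v3 v5 v6] := UW0 v f1 f2 u0 w0; apply: coord0.
have [||v|L LE dL] := @zero_locus_dim _ _ (m :: ls) [:: U; W].
- move=> f; rewrite mem_cat inE -orbA => /or3P[/eqP -> //|/lsh //|].
  by rewrite !inE => /orP[] /eqP ->.
- by [].
- rewrite /common_zero /= !evalv_var andbT.
  case/and5P=> /eqP m0 /eqP vz' /eqP f1 /eqP f2 /andP[/eqP u0 /eqP w0].
  have [v2 v3 v5 v6] := UW0 v f1 f2 u0 w0.
  (* Once the other forms vanish, [m] reduces to [nz] times the coordinate [z]. *)
  move: m0; rewrite /m evalvD N_z // evalvZ evalvD 2!evalvZ u0 w0 !(mulr0, addr0).
  by move/eqP; rewrite mulf_eq0 (negPf nz0) /= => /eqP vz; apply: coord0.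
exists L; split=> [|v].
  split; first by exists P.
  split; first by [].
  exists m; split=> //; apply: same_subscheme_gens => f.
    rewrite mem_cat => /orP[fls|]; first by apply: in_ideal_mem; rewrite inE fls orbT.
    have [|iz iQ1 iM iR] := ideal_ls (m ^+ 2 :: ls).
      by move=> h hls; rewrite inE hls orbT.
    rewrite !inE => /or3P[] /eqP -> //.
      rewrite /Q2 -addrA NE; apply: in_idealD; apply: in_idealD => //.
      - exact: in_idealZ.
      - exact: in_idealZ.
      - by apply: in_ideal_mem; rewrite mem_head.
    rewrite /Q3 ME; apply: in_idealD; last exact: in_idealMl.
    by apply: in_idealD; apply: in_idealZ.
  have [|iz iQ1 iM iR] := ideal_ls (ls ++ [:: Q1; Q2; Q3]).
    by move=> h hls; rewrite mem_cat hls.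
  rewrite inE => /predU1P[->|fls]; last first.
    by apply: in_ideal_mem; rewrite mem_cat fls.
  have -> : m ^+ 2 = Q2 + (c *: Q1 + e *: ('X_z * 'X_z'))
      + (F1 * F2 + (H + (s * w) *: M) * M).
    transitivity (N ^+ 2 + A * B + (F1 * F2 + (H + (s * w) *: M) * M)).
      rewrite NE; char2_ring mchar2.
    rewrite /Q2; char2_ring mchar2.
  apply: in_idealD => //; apply: in_idealD.
    by apply: in_ideal_mem; rewrite mem_cat !inE eqxx !orbT.
  by apply: in_idealD; apply: in_idealZ.
rewrite LE /common_zero /= andbT evalv_var.
case: (v 0 z' =P 0) => [vz'|_] /=; last by rewrite andbF.
case: (evalv F1 v =P 0) => [f1|_] /=; last by rewrite andbF.
case: (evalv F2 v =P 0) => [f2|_] /=; last by rewrite andbF.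
have -> : evalv N v ^+ 2 + evalv A v * evalv B v = evalv m v ^+ 2.
  have M0 : evalv M v = 0 by rewrite evalvD 2!evalvZ f1 f2 !mulr0 addr0.
  rewrite -[in LHS]evalvXn -evalvM -evalvD NE evalvD evalvXn (evalvD (F1 * F2)) evalvM.
  by rewrite f1 mul0r add0r evalvM M0 mulr0 addr0.
by rewrite andbT expf_eq0.
Qed.
End DoubleLine.

(** * Squares of lines *)

(** The traces of [E] and [E'] on [T] are independent and nonzero inside a space of dimension 2, so
    each has dimension 1. *)
Lemma dim_meet_disjoint (k : fieldType) (vT : vectType k) (T E E' : {vspace vT}) :
  \dim T = 2%N ->
  (E :&: E' = 0)%VS -> (T :&: E != 0)%VS -> (T :&: E' != 0)%VS ->
  \dim (T :&: E) = 1%N.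
Proof.
move=> dT EE' TE TE'; have := dimvS (capvSl T (E + E')).
rewrite dT => le2.
have d0 : ((T :&: E) :&: (T :&: E') = 0)%VS.
  apply/eqP; rewrite -subv0 -EE' subv_cap.
  by rewrite (subv_trans (capvSl _ _)) ?(subv_trans (capvSr _ _)) ?capvSr.
have le : (T :&: E + (T :&: E') <= T :&: (E + E'))%VS.
  by rewrite subv_cap subv_add !capvSl addvS ?capvSr.
have := leq_trans (dimvS le) le2; rewrite dimv_disjoint_sum //.
by move: TE TE'; rewrite -!dimv_eq0; lia.
Qed.

Section Square.
Variables (k : fieldType) (vT : vectType k) (T1 T2 E1 E2 : {vspace vT}).
Hypotheses (dT1 : \dim T1 = 2%N) (dT2 : \dim T2 = 2%N).
Hypotheses (dE1 : \dim E1 = 2%N) (dE2 : \dim E2 = 2%N).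
Hypotheses (TT0 : (T1 :&: T2 = 0)%VS) (EE0 : (E1 :&: E2 = 0)%VS).
Hypotheses (TE11 : (T1 :&: E1 != 0)%VS) (TE12 : (T1 :&: E2 != 0)%VS).
Hypotheses (TE21 : (T2 :&: E1 != 0)%VS) (TE22 : (T2 :&: E2 != 0)%VS).

Lemma square_dims : [/\ \dim (T1 :&: E1) = 1, \dim (T1 :&: E2) = 1,
  \dim (T2 :&: E1) = 1 & \dim (T2 :&: E2) = 1]%N.
Proof.
have EE0' : (E2 :&: E1 = 0)%VS by rewrite capvC.
by split; [apply: (dim_meet_disjoint _ EE0) | apply: (dim_meet_disjoint _ EE0')
          | apply: (dim_meet_disjoint _ EE0) | apply: (dim_meet_disjoint _ EE0')].
Qed.

Lemma meet_neq (L M K : {vspace vT}) :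
  (L :&: K != 0)%VS -> (M :&: K = 0)%VS -> L != M.
Proof. by move=> LK MK; apply: contraNneq LK => ->; rewrite MK. Qed.

(** Any two of the lines are separated by a third space that meets one of them and misses the
    other. *)
Lemma square_uniq : uniq [:: T1; T2; E1; E2].
Proof.
have neq0 L : \dim L = 2%N -> L != 0%VS by move=> dL; rewrite -dimv_eq0 dL.
have TT0' : (T2 :&: T1 = 0)%VS by rewrite capvC.
have EE0' : (E2 :&: E1 = 0)%VS by rewrite capvC.
have T12 : T1 != T2 by apply: (@meet_neq _ _ T1); rewrite ?capvv ?neq0.
have E12 : E1 != E2 by apply: (@meet_neq _ _ E1); rewrite ?capvv ?neq0.
have TE1 : T1 != E1 by apply: (@meet_neq _ _ E2).
have TE2 : T1 != E2 by apply: (@meet_neq _ _ E1).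
have TE3 : T2 != E1 by apply: (@meet_neq _ _ E2).
have TE4 : T2 != E2 by apply: (@meet_neq _ _ E1).
by rewrite /= !inE !negb_or T12 E12 TE1 TE2 TE3 TE4.
Qed.

Definition vertices := [:: T1 :&: E1; T1 :&: E2; T2 :&: E1; T2 :&: E2]%VS.

(** If two vertices coincided, their common point would lie on two opposite lines, which are
    disjoint. *)
Lemma vertices_uniq : uniq vertices.
Proof.
rewrite /= !inE !negb_or -!andbA andbT; do 5?[apply/andP; split];
  apply/eqP => E; move: TE11 TE12 TE21 TE22.
- by move=> + _ _ _; apply/negP/negPn; rewrite -subv0 -EE0 subv_cap capvSr E capvSr.
- by move=> + _ _ _; apply/negP/negPn; rewrite -subv0 -TT0 subv_cap capvSl E capvSl.
- by move=> + _ _ _; apply/negP/negPn; rewrite -subv0 -TT0 subv_cap capvSl E capvSl.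
- by move=> _ + _ _; apply/negP/negPn; rewrite -subv0 -TT0 subv_cap capvSl E capvSl.
- by move=> _ + _ _; apply/negP/negPn; rewrite -subv0 -TT0 subv_cap capvSl E capvSl.
- by move=> _ _ + _; apply/negP/negPn; rewrite -subv0 -EE0 subv_cap capvSr E capvSr.
Qed.

Lemma vertices_meet (V : {vspace vT}) : V \in vertices <->
  \dim V = 1%N /\ exists L M : {vspace vT},
    [/\ L \in [:: T1; T2; E1; E2], M \in [:: T1; T2; E1; E2], L != M
      & (V <= L :&: M)%VS].
Proof.
have [d11 d12 d21 d22] := square_dims.
have [T12 E12 TE1 [TE2 TE3 TE4]] : [/\ T1 != T2, E1 != E2, T1 != E1 &
    [/\ T1 != E2, T2 != E1 & T2 != E2]].
  have := square_uniq; rewrite /= !inE !negb_or -!andbA.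
  by move=> /and5P[-> -> -> -> /and3P[-> ->]].
split.
  rewrite !inE => /or4P[] /eqP ->; split=> //.
  - by exists T1, E1; rewrite !inE !eqxx ?orbT.
  - by exists T1, E2; rewrite !inE !eqxx ?orbT.
  - by exists T2, E1; rewrite !inE !eqxx ?orbT.
  - by exists T2, E2; rewrite !inE !eqxx ?orbT.
case=> dV [L [M [hL hM LM VLM]]].
have eqV W : \dim W = 1%N -> (V <= W)%VS -> V = W.
  by move=> dW VW; apply/eqP; rewrite eqEdim VW dV dW.
have neV0 : ~~ (V <= 0)%VS by rewrite subv0 -dimv_eq0 dV.
(* Of the sixteen pairs, equal lines contradict [L != M], opposite lines meet in zero, and adjacent
   lines, in either order, give a vertex. *)
move: hL hM; rewrite !inE => /or4P[] /eqP LE /or4P[] /eqP ME;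
  move: LM VLM; rewrite {L}LE {M}ME ?eqxx ?TT0 ?EE0 ?(negPf neV0) //
  => _; rewrite ?[(E1 :&: T1)%VS]capvC ?[(E1 :&: T2)%VS]capvC
    ?[(E2 :&: T1)%VS]capvC ?[(E2 :&: T2)%VS]capvC
    ?[(T2 :&: T1)%VS]capvC ?[(E2 :&: E1)%VS]capvC ?TT0 ?EE0 ?(negPf neV0) //;
  by move/eqV=> ->; rewrite ?eqxx ?orbT.
Qed.

End Square.

(** * Points and lines of the surface *)

Section SurfacePoints.
Variables (k : closedFieldType) (char2 : 2%N \in [pchar k]).
Variables (p q r t e : k) (nc nd : 'I_3 -> k).
Hypothesis e0 : e != 0.
Implicit Types (v h g : 'rV[k]_(3 + 3)).

Definition x1 v := v 0 (lshift 3 i1).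
Definition x2 v := v 0 (lshift 3 i2).
Definition x3 v := v 0 (lshift 3 i3).
Definition y1 v := v 0 (rshift 3 i1).
Definition y2 v := v 0 (rshift 3 i2).
Definition y3 v := v 0 (rshift 3 i3).

Lemma coord_eq0 v : x1 v = 0 -> x2 v = 0 -> x3 v = 0 ->
  y1 v = 0 -> y2 v = 0 -> y3 v = 0 -> v = 0.
Proof.
rewrite /x1 /x2 /x3 /y1 /y2 /y3 => h1 h2 h3 h4 h5 h6.
apply/rowP => i; rewrite mxE -(splitK i).
case: (split i) => -[[|[|[|//]]] lt3] /=.
- by rewrite -[RHS]h1; congr (v _ (lshift _ _)); apply: val_inj.
- by rewrite -[RHS]h2; congr (v _ (lshift _ _)); apply: val_inj.
- by rewrite -[RHS]h3; congr (v _ (lshift _ _)); apply: val_inj.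
- by rewrite -[RHS]h4; congr (v _ (rshift _ _)); apply: val_inj.
- by rewrite -[RHS]h5; congr (v _ (rshift _ _)); apply: val_inj.
- by rewrite -[RHS]h6; congr (v _ (rshift _ _)); apply: val_inj.
Qed.

Definition fA v := q ^+ 2 * x2 v + p ^+ 2 * y2 v.
Definition fB v := t ^+ 2 * x3 v + r ^+ 2 * y3 v.
Definition fM v := r * t * fA v + p * q * fB v.
Definition fN v := nc i1 * x1 v + nd i1 * y1 v
  + (nc i2 * x2 v + nd i2 * y2 v) + (nc i3 * x3 v + nd i3 * y3 v).
Definition fF1 v := q * r * x2 v + p * t * x3 v.
Definition fF2 v := p * t * y2 v + q * r * y3 v.
Definition fG1 v := q * t * x2 v + p * r * y3 v.
Definition fG2 v := q * t * x3 v + p * r * y2 v.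
Definition fR v := fN v ^+ 2 + fA v * fB v.
Definition fq v := x2 v * y2 v + x3 v * y3 v.

(* The three equations of the surface, simplified by subtracting multiples of
   the first one. *)
Definition on_surface v := [/\ x1 v * y1 v + fq v = 0,
  e * (x1 v * y1 v) + fR v = 0 & e ^+ 2 * (x1 v * y1 v) + fM v ^+ 2 = 0].

(** Adding [y1 v = 0] or [x1 v = 0] to this condition gives the lines [T1] and [E1]; [onG] gives
    [E2] and [T2] likewise. *)
Definition onF v := [&& fF1 v == 0, fF2 v == 0 & fR v == 0].
Definition onG v := [&& fG1 v == 0, fG2 v == 0 & fR v == 0].

(* [N] at the vertex (p^2 r t, p q r^2, q^2 r t, p q t^2) of the quadric cone
   [fM = fq = 0]; the complex is non-singular when this value is not zero. *)
Hypothesis nw0 : nc i2 * (p ^+ 2 * r * t) + nd i2 * (q ^+ 2 * r * t)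
  + nc i3 * (p * q * r ^+ 2) + nd i3 * (p * q * t ^+ 2) != 0.

(** Every term of the expression in [nw0] is a multiple of p t or of q r; the same holds with p r
    and q t, which gives [prqt]. *)
Lemma ptqr : (p * t != 0) || (q * r != 0).
Proof.
apply: contraNT nw0; rewrite negb_or !negbK => /andP[/eqP pt /eqP qr].
apply/eqP; transitivity (nc i2 * (p * r * (p * t)) + nd i2 * (q * t * (q * r))
  + nc i3 * (p * r * (q * r)) + nd i3 * (q * t * (p * t))); first by ring.
by rewrite pt qr !mulr0 !addr0.
Qed.

Lemma prqt : (p * r != 0) || (q * t != 0).
Proof.
apply: contraNT nw0; rewrite negb_or !negbK => /andP[/eqP pr /eqP qt].
apply/eqP; transitivity (nc i2 * (p * t * (p * r)) + nd i2 * (q * r * (q * t))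
  + nc i3 * (q * r * (p * r)) + nd i3 * (p * t * (q * t))); first by ring.
by rewrite pr qt !mulr0 !addr0.
Qed.

(** In the coordinates (X2, X3, Y2, Y3), the plane M = 0 is tangent to the quadric [fq] = 0 at the
    point whose coordinates are the coefficients of [fq] here. The section therefore splits into the
    lines F1 = F2 = 0 and G1 = G2 = 0. *)
Lemma FG_products v : [/\ fF1 v * fG1 v = x2 v * fM v + p ^+ 2 * r * t * fq v,
  fF1 v * fG2 v = x3 v * fM v + p * q * r ^+ 2 * fq v,
  fF2 v * fG1 v = y3 v * fM v + p * q * t ^+ 2 * fq v &
  fF2 v * fG2 v = y2 v * fM v + q ^+ 2 * r * t * fq v].
Proof.
by split; rewrite /fF1 /fF2 /fG1 /fG2 /fM /fq /fA /fB; char2_ring char2.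
Qed.

Lemma FG_dichotomy v : fM v = 0 -> fq v = 0 ->
  (fF1 v = 0 /\ fF2 v = 0) \/ (fG1 v = 0 /\ fG2 v = 0).
Proof.
have [] := FG_products v => + + + + M0 q0; rewrite M0 q0 !mulr0 addr0.
move=> /eqP + /eqP + /eqP + /eqP; rewrite !mulf_eq0.
case: (fF1 v =P 0) => [f1|_] /=; case: (fF2 v =P 0) => [f2|_] /=.
- by left.
- by move=> _ _ /eqP g1 /eqP g2; right.
- by move=> /eqP g1 /eqP g2; right.
- by move=> /eqP g1 /eqP g2; right.
Qed.

(** Both p t and q r times [fq] are combinations of F1 and F2, and one of these scalars is nonzero
    by [ptqr]. *)
Lemma F_vanish v : fF1 v = 0 -> fF2 v = 0 -> fq v = 0 /\ fM v = 0.
Proof.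
move=> f1 f2; split.
  apply: (cancel_pair ptqr).
    transitivity (x2 v * fF2 v + y3 v * fF1 v); last by rewrite f1 f2 !mulr0 addr0.
    by rewrite /fF1 /fF2 /fq; char2_ring char2.
  transitivity (y2 v * fF1 v + x3 v * fF2 v); last by rewrite f1 f2 !mulr0 addr0.
  by rewrite /fF1 /fF2 /fq; char2_ring char2.
transitivity (q * t * fF1 v + p * r * fF2 v); last by rewrite f1 f2 !mulr0 addr0.
by rewrite /fM /fA /fB /fF1 /fF2; char2_ring char2.
Qed.

Lemma G_vanish v : fG1 v = 0 -> fG2 v = 0 -> fq v = 0 /\ fM v = 0.
Proof.
move=> g1 g2; split.
  apply: (cancel_pair prqt).
    transitivity (x2 v * fG2 v + x3 v * fG1 v); last by rewrite g1 g2 !mulr0 addr0.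
    by rewrite /fG1 /fG2 /fq; char2_ring char2.
  transitivity (y2 v * fG1 v + y3 v * fG2 v); last by rewrite g1 g2 !mulr0 addr0.
  by rewrite /fG1 /fG2 /fq; char2_ring char2.
transitivity (q * r * fG1 v + p * t * fG2 v); last by rewrite g1 g2 !mulr0 addr0.
by rewrite /fM /fA /fB /fG1 /fG2; char2_ring char2.
Qed.

(** Both p t and q r times A, and likewise times B, are combinations of the four forms. *)
Lemma FG_AB v : fF1 v = 0 -> fF2 v = 0 -> fG1 v = 0 -> fG2 v = 0 ->
  fA v = 0 /\ fB v = 0.
Proof.
move=> f1 f2 g1 g2; split; apply: (cancel_pair ptqr).
- transitivity (p * q * fG1 v + p ^+ 2 * fF2 v).
    by rewrite /fA /fG1 /fF2; char2_ring char2.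
  by rewrite g1 f2 !mulr0 addr0.
- transitivity (p * q * fG2 v + q ^+ 2 * fF1 v).
    by rewrite /fA /fG2 /fF1; char2_ring char2.
  by rewrite g2 f1 !mulr0 addr0.
- transitivity (r * t * fG1 v + t ^+ 2 * fF1 v).
    by rewrite /fB /fG1 /fF1; char2_ring char2.
  by rewrite g1 f1 !mulr0 addr0.
- transitivity (r * t * fG2 v + r ^+ 2 * fF2 v).
    by rewrite /fB /fG2 /fF2; char2_ring char2.
  by rewrite g2 f2 !mulr0 addr0.
Qed.

(** The square of each of the four forms lies in the ideal generated by A, B and [fq]. *)
Lemma AB_FG v : fA v = 0 -> fB v = 0 -> fq v = 0 ->
  [/\ fF1 v = 0, fF2 v = 0, fG1 v = 0 & fG2 v = 0].
Proof.
move=> A0 B0 q0; split; apply/eqP; rewrite -sqrf_eq0; apply/eqP.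
- transitivity (r ^+ 2 * x2 v * fA v + p ^+ 2 * x3 v * fB v + p ^+ 2 * r ^+ 2 * fq v).
    by rewrite /fF1 /fA /fB /fq; char2_ring char2.
  by rewrite A0 B0 q0 !mulr0 !addr0.
- transitivity (t ^+ 2 * y2 v * fA v + q ^+ 2 * y3 v * fB v + q ^+ 2 * t ^+ 2 * fq v).
    by rewrite /fF2 /fA /fB /fq; char2_ring char2.
  by rewrite A0 B0 q0 !mulr0 !addr0.
- transitivity (t ^+ 2 * x2 v * fA v + p ^+ 2 * y3 v * fB v + p ^+ 2 * t ^+ 2 * fq v).
    by rewrite /fG1 /fA /fB /fq; char2_ring char2.
  by rewrite A0 B0 q0 !mulr0 !addr0.
- transitivity (r ^+ 2 * y2 v * fA v + q ^+ 2 * x3 v * fB v + q ^+ 2 * r ^+ 2 * fq v).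
    by rewrite /fG2 /fA /fB /fq; char2_ring char2.
  by rewrite A0 B0 q0 !mulr0 !addr0.
Qed.

(* [v] is proportional to the vertex because the 2x2 minors of the two vectors
   are multiples of [fA], [fB] and the four forms [fF1], ..., [fG2]. *)
Lemma vertex_eq0 v : x1 v = 0 -> y1 v = 0 ->
  fF1 v = 0 -> fF2 v = 0 -> fG1 v = 0 -> fG2 v = 0 -> fR v = 0 -> v = 0.
Proof.
move=> vx1 vy1 f1 f2 g1 g2 R0; have [A0 B0] := FG_AB f1 f2 g1 g2.
have N0 : fN v = 0.
  by move/eqP: R0; rewrite /fR A0 mul0r addr0 sqrf_eq0 => /eqP.
have cancel x w : x * (nc i2 * (p ^+ 2 * r * t) + nd i2 * (q ^+ 2 * r * t)
    + nc i3 * (p * q * r ^+ 2) + nd i3 * (p * q * t ^+ 2)) + w * fN v = 0 -> x = 0.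
  by rewrite N0 mulr0 addr0 => /eqP; rewrite mulf_eq0 (negPf nw0) orbF => /eqP.
apply: coord_eq0 => //.
- apply: (cancel _ (p ^+ 2 * r * t)).
  transitivity (nd i2 * (r * t) * fA v + nc i3 * (p * r) * fF1 v
    + nd i3 * (p * t) * fG1 v + p ^+ 2 * r * t * (nc i1 * x1 v + nd i1 * y1 v)).
    by rewrite /fN /fA /fF1 /fG1; char2_ring char2.
  by rewrite A0 f1 g1 vx1 vy1 !(mulr0, addr0).
- apply: (cancel _ (p * q * r ^+ 2)).
  transitivity (nd i3 * (p * q) * fB v + nc i2 * (p * r) * fF1 v
    + nd i2 * (q * r) * fG2 v + p * q * r ^+ 2 * (nc i1 * x1 v + nd i1 * y1 v)).
    by rewrite /fN /fB /fF1 /fG2; char2_ring char2.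
  by rewrite B0 f1 g2 vx1 vy1 !(mulr0, addr0).
- apply: (cancel _ (q ^+ 2 * r * t)).
  transitivity (nc i2 * (r * t) * fA v + nd i3 * (q * t) * fF2 v
    + nc i3 * (q * r) * fG2 v + q ^+ 2 * r * t * (nc i1 * x1 v + nd i1 * y1 v)).
    by rewrite /fN /fA /fF2 /fG2; char2_ring char2.
  by rewrite A0 f2 g2 vx1 vy1 !(mulr0, addr0).
- apply: (cancel _ (p * q * t ^+ 2)).
  transitivity (nc i3 * (p * q) * fB v + nd i2 * (q * t) * fF2 v
    + nc i2 * (p * t) * fG1 v + p * q * t ^+ 2 * (nc i1 * x1 v + nd i1 * y1 v)).
    by rewrite /fN /fB /fF2 /fG1; char2_ring char2.
  by rewrite B0 f2 g1 vx1 vy1 !(mulr0, addr0).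
Qed.

Lemma onF_surface v : x1 v * y1 v = 0 -> onF v -> on_surface v.
Proof.
move=> xy /and3P[/eqP f1 /eqP f2 /eqP R0]; have [q0 M0] := F_vanish f1 f2.
by rewrite /on_surface xy q0 R0 M0 !mulr0 expr0n !addr0.
Qed.

Lemma onG_surface v : x1 v * y1 v = 0 -> onG v -> on_surface v.
Proof.
move=> xy /and3P[/eqP f1 /eqP f2 /eqP R0]; have [q0 M0] := G_vanish f1 f2.
by rewrite /on_surface xy q0 R0 M0 !mulr0 expr0n !addr0.
Qed.

Lemma surface_onFG v : on_surface v -> x1 v * y1 v = 0 -> onF v || onG v.
Proof.
rewrite /on_surface => + xy; rewrite xy mulr0 !add0r mulr0 add0r.
move=> [q0 R0 /eqP]; rewrite sqrf_eq0 => /eqP M0; rewrite /onF /onG R0 eqxx !andbT.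
by case: (FG_dichotomy M0 q0) => -[-> ->]; rewrite eqxx ?orbT.
Qed.

Lemma onFG_eq0 v : x1 v = 0 -> y1 v = 0 -> onF v -> onG v -> v = 0.
Proof.
move=> vx vy /and3P[/eqP f1 /eqP f2 /eqP R0] /and3P[/eqP g1 /eqP g2 _].
exact: vertex_eq0.
Qed.

(** Squares are additive in characteristic 2, so polarizing the third equation leaves e^2 times the
    polar form of X1 Y1; the second equation then leaves the polar form of A B. *)
Lemma surface_polar h g : on_surface h -> on_surface g -> on_surface (h + g) ->
  x1 h * y1 g + x1 g * y1 h = 0 /\ fA h * fB g + fA g * fB h = 0.
Proof.
have addE (i : 'I_(3 + 3)) : (h + g) 0 i = h 0 i + g 0 i by rewrite mxE.
move=> [_ h2 h3] [_ g2 g3] [_ s2 s3].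
have P1 : x1 h * y1 g + x1 g * y1 h = 0.
  apply: (mulfI (expf_neq0 2 e0)); rewrite mulr0.
  transitivity (e ^+ 2 * (x1 (h + g) * y1 (h + g)) + fM (h + g) ^+ 2
    + (e ^+ 2 * (x1 h * y1 h) + fM h ^+ 2)
    + (e ^+ 2 * (x1 g * y1 g) + fM g ^+ 2)); last by rewrite s3 h3 g3 !addr0.
  by rewrite /fM /fA /fB /x1 /x2 /x3 /y1 /y2 /y3 !addE; char2_ring char2.
split=> //.
transitivity (e * (x1 (h + g) * y1 (h + g)) + fR (h + g)
  + (e * (x1 h * y1 h) + fR h) + (e * (x1 g * y1 g) + fR g)
  + e * (x1 h * y1 g + x1 g * y1 h)); last by rewrite s2 h2 g2 P1 mulr0 !addr0.
by rewrite /fR /fN /fA /fB /x1 /x2 /x3 /y1 /y2 /y3 !addE; char2_ring char2.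
Qed.

(** If X1 Y1 did not vanish at [g], neither would M. Since M vanishes at [h], polarity gives A(h)
    M(g) = B(h) M(g) = 0, and [vertex_eq0] would make [h] zero. *)
Lemma surface_secant h g : on_surface h -> on_surface g -> on_surface (h + g) ->
  x1 h = 0 -> y1 h = 0 -> h != 0 -> x1 g * y1 g = 0.
Proof.
move=> hS gS hgS hx hy h0; have [P1 P3] := surface_polar hS gS hgS.
case: hS; rewrite hx mul0r mulr0 !add0r mulr0 add0r => q0 R0 /eqP.
rewrite sqrf_eq0 => /eqP M0.
case: gS => _ _ gM; apply/eqP; apply: contraNT h0 => xy.
have Mg : fM g != 0.
  apply: contraNneq xy => Mg; move: gM; rewrite Mg expr0n addr0 => /eqP.
  by rewrite mulf_eq0 expf_eq0 (negPf e0).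
have A0 : fA h = 0.
  apply: (mulIf Mg); rewrite mul0r.
  transitivity (fM h * fA g + p * q * (fA h * fB g + fA g * fB h)).
    by rewrite /fM; char2_ring char2.
  by rewrite M0 P3 mul0r mulr0 addr0.
have B0 : fB h = 0.
  apply: (mulIf Mg); rewrite mul0r.
  transitivity (fM h * fB g + r * t * (fA h * fB g + fA g * fB h)).
    by rewrite /fM; char2_ring char2.
  by rewrite M0 P3 mul0r mulr0 addr0.
have [f1 f2 g1 g2] := AB_FG A0 B0 q0.
by apply/eqP; apply: vertex_eq0.
Qed.

(** * Incidence of the four lines, lines on the surface, singular points *)

Variables (S : seq {mpoly k[3 + 3]}) (T1 T2 E1 E2 : {vspace 'rV[k]_(3 + 3)}).
Hypothesis S_surface : forall v, common_zero S v <-> on_surface v.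
Hypotheses (dT1 : \dim T1 = 2%N) (dT2 : \dim T2 = 2%N).
Hypotheses (dE1 : \dim E1 = 2%N) (dE2 : \dim E2 = 2%N).
Hypothesis memT1 : forall v, (v \in T1) = (y1 v == 0) && onF v.
Hypothesis memT2 : forall v, (v \in T2) = (x1 v == 0) && onG v.
Hypothesis memE1 : forall v, (v \in E1) = (x1 v == 0) && onF v.
Hypothesis memE2 : forall v, (v \in E2) = (y1 v == 0) && onG v.

Lemma T1T2_disjoint : (T1 :&: T2 = 0)%VS.
Proof.
apply/eqP; rewrite -subv0; apply/subvP => v; rewrite memv_cap memT1 memT2 memv0.
by move=> /andP[/andP[/eqP vy F] /andP[/eqP vx G]]; apply/eqP/onFG_eq0.
Qed.

Lemma E1E2_disjoint : (E1 :&: E2 = 0)%VS.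
Proof.
apply/eqP; rewrite -subv0; apply/subvP => v; rewrite memv_cap memE1 memE2 memv0.
by move=> /andP[/andP[/eqP vx F] /andP[/eqP vy G]]; apply/eqP/onFG_eq0.
Qed.

(** As a line contains a zero of every linear form, it is enough that a single linear condition on
    [U] implies membership in [V]. *)
Lemma cap_neq0 (U V : {vspace 'rV[k]_(3 + 3)}) f : \dim U = 2%N ->
  f \is 1.-homog -> {in U, forall v, evalv f v = 0 -> v \in V} ->
  (U :&: V != 0)%VS.
Proof.
move=> dU hf UV; have [|v [vU v0 fv]] := @form_vanishes_somewhere _ _ U f _ hf.
  by rewrite dU.
apply: contraNneq v0 => UV0; rewrite -memv0 -UV0 memv_cap vU; exact: UV.
Qed.

Lemma T1E1_neq0 : (T1 :&: E1 != 0)%VS.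
Proof.
apply: (cap_neq0 dT1 (var_homog1 _ (lshift 3 i1))) => v; rewrite memT1 memE1.
by case/andP=> _ -> vx; rewrite /x1 -evalv_var vx eqxx.
Qed.

Lemma T2E2_neq0 : (T2 :&: E2 != 0)%VS.
Proof.
apply: (cap_neq0 dT2 (var_homog1 _ (rshift 3 i1))) => v; rewrite memT2 memE2.
by case/andP=> _ -> vy; rewrite /y1 -evalv_var vy eqxx.
Qed.

(** On [T1] the form M = q r G1 + p t G2 vanishes, so G1 and G2 are proportional and both are
    multiples of s G1 + w G2. [T2E1_neq0] is dual, with M = q t F1 + p r F2. *)
Lemma T1E2_neq0 : (T1 :&: E2 != 0)%VS.
Proof.
have [s [w sw]] := normalized_pair ptqr.
pose G1 : {mpoly k[3 + 3]} := (q * t) *: X k i2 + (p * r) *: Y k i3.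
pose G2 : {mpoly k[3 + 3]} := (q * t) *: X k i3 + (p * r) *: Y k i2.
apply: (cap_neq0 dT1 (f := s *: G1 + w *: G2)) => [|v].
  by apply: dhomogD; apply: dhomogZ; apply: dhomogD; apply: dhomogZ;
    apply: var_homog1.
rewrite memT1 memE2 /onF /onG => /andP[-> /and3P[/eqP f1 /eqP f2 ->]].
rewrite !evalvE -/(x2 v) -/(x3 v) -/(y2 v) -/(y3 v) -/(fG1 v) -/(fG2 v) => g0.
have [_ M0] := F_vanish f1 f2; rewrite andbT /=; apply/andP; split; apply/eqP.
  rewrite -[LHS]mul1r -sw.
  transitivity (p * t * (s * fG1 v + w * fG2 v) + w * fM v).
    by rewrite /fM /fA /fB /fG1 /fG2; char2_ring char2.
  by rewrite g0 M0 !mulr0 addr0.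
rewrite -[LHS]mul1r -sw.
transitivity (q * r * (s * fG1 v + w * fG2 v) + s * fM v).
  by rewrite /fM /fA /fB /fG1 /fG2; char2_ring char2.
by rewrite g0 M0 !mulr0 addr0.
Qed.

Lemma T2E1_neq0 : (T2 :&: E1 != 0)%VS.
Proof.
have [s [w sw]] := normalized_pair prqt.
pose F1 : {mpoly k[3 + 3]} := (q * r) *: X k i2 + (p * t) *: X k i3.
pose F2 : {mpoly k[3 + 3]} := (p * t) *: Y k i2 + (q * r) *: Y k i3.
apply: (cap_neq0 dT2 (f := s *: F1 + w *: F2)) => [|v].
  by apply: dhomogD; apply: dhomogZ; apply: dhomogD; apply: dhomogZ;
    apply: var_homog1.
rewrite memT2 memE1 /onF /onG => /andP[-> /and3P[/eqP g1 /eqP g2 ->]].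
rewrite !evalvE -/(x2 v) -/(x3 v) -/(y2 v) -/(y3 v) -/(fF1 v) -/(fF2 v) => f0.
have [_ M0] := G_vanish g1 g2; rewrite andbT /=; apply/andP; split; apply/eqP.
  rewrite -[LHS]mul1r -sw.
  transitivity (p * r * (s * fF1 v + w * fF2 v) + w * fM v).
    by rewrite /fM /fA /fB /fF1 /fF2; char2_ring char2.
  by rewrite f0 M0 !mulr0 addr0.
rewrite -[LHS]mul1r -sw.
transitivity (q * t * (s * fF1 v + w * fF2 v) + s * fM v).
  by rewrite /fM /fA /fB /fF1 /fF2; char2_ring char2.
by rewrite f0 M0 !mulr0 addr0.
Qed.

(** A vector space is not the union of two proper subspaces: the sum of a vector outside [U] and one
    outside [V] would lie in neither. *)
Lemma sub_either (L U V : {vspace 'rV[k]_(3 + 3)}) :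
  {in L, forall v, (v \in U) || (v \in V)} -> (L <= U)%VS || (L <= V)%VS.
Proof.
move=> LUV; apply/negPn/negP; rewrite negb_or => /andP[/subvPn[u uL uU] /subvPn[v vL vV]].
have uV : u \in V by have := LUV u uL; rewrite (negPf uU).
have vU : v \in U by have := LUV v vL; rewrite (negPf vV) orbF.
have /orP[] := LUV _ (memvD uL vL).
  by rewrite (rpredDr _ vU) (negPf uU).
by rewrite (rpredDl _ uV) (negPf vV).
Qed.

(** A line of the surface lies in X1 = 0 or in Y1 = 0. All its points then satisfy [onF] or [onG],
    and [sub_either] selects one condition for the whole line. *)
Lemma lines_on_surface (L : {vspace 'rV[k]_(3 + 3)}) :
  (\dim L = 2)%N /\ contained L S <-> L \in [:: T1; T2; E1; E2].
Proof.
split; last first.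
  rewrite !inE => /or4P[] /eqP ->; split=> // v; rewrite ?memT1 ?memT2 ?memE1 ?memE2;
    case/andP=> /eqP v0 vFG; apply/S_surface.
  - by apply: onF_surface; rewrite // v0 mulr0.
  - by apply: onG_surface; rewrite // v0 mul0r.
  - by apply: onF_surface; rewrite // v0 mul0r.
  - by apply: onG_surface; rewrite // v0 mulr0.
move=> [dL LS]; have LSv v : v \in L -> on_surface v by move=> /LS /S_surface.
have eqL (V : {vspace 'rV[k]_(3 + 3)}) : (L <= V)%VS -> \dim V = 2%N -> L = V.
  by move=> LV dV; apply/eqP; rewrite eqEdim LV dL dV.
have [[u [uL xu]]|Lx] : (exists u, u \in L /\ x1 u != 0) \/
    {in L, forall v, x1 v = 0}.
  have [|U UE _] := @zero_locus_exists k _ [:: X k i1].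
    by move=> f; rewrite inE => /eqP ->; exact: var_homog1.
  have UE' v : (v \in U) = (x1 v == 0) by rewrite UE /common_zero /= evalv_var andbT.
  case LU: (L <= U)%VS; last first.
    by left; move/negbT: LU => /subvPn[u uL]; rewrite UE'; exists u.
  by right=> v /(subvP LU); rewrite UE' => /eqP.
(* If X1 is not identically zero on [L], take a zero [h] of X1: polarity with [u] gives Y1(h) = 0,
   the secant lemma gives Y1(u) = 0, and polarity with [u] again gives Y1 = 0 on all of [L]. *)
- have [|h [hL h0]] := @form_vanishes_somewhere _ _ L (X k i1) _ (var_homog1 _ _).
    by rewrite dL.
  rewrite evalv_var -/(x1 h) => hx.
  have polar v w : v \in L -> w \in L -> x1 v * y1 w + x1 w * y1 v = 0.
    move=> vL wL; have [] := surface_polar (LSv _ vL) (LSv _ wL) => //.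
    exact/LSv/memvD.
  have hy : y1 h = 0.
    have /eqP := polar _ _ hL uL; rewrite hx mul0r add0r mulf_eq0 (negPf xu) /=.
    by move/eqP.
  have uy : y1 u = 0.
    have /eqP := surface_secant (LSv _ hL) (LSv _ uL) (LSv _ (memvD hL uL)) hx hy h0.
    by rewrite mulf_eq0 (negPf xu) /= => /eqP.
  have Ly v : v \in L -> y1 v = 0.
    move=> vL; have /eqP := polar _ _ uL vL.
    by rewrite uy mulr0 addr0 mulf_eq0 (negPf xu) /= => /eqP.
  have /orP[/eqL ->|/eqL ->] : (L <= T1)%VS || (L <= E2)%VS; rewrite ?inE ?eqxx ?orbT //.
  apply: sub_either => v vL; rewrite memT1 memE2 Ly // eqxx /=.
  by apply: surface_onFG (LSv _ vL) _; rewrite Ly ?mulr0.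
- have /orP[/eqL ->|/eqL ->] : (L <= E1)%VS || (L <= T2)%VS; rewrite ?inE ?eqxx ?orbT //.
  apply: sub_either => v vL; rewrite memE1 memT2 Lx // eqxx /=.
  by apply: surface_onFG (LSv _ vL) _; rewrite Lx ?mul0r.
Qed.

Hypothesis rank_jacobian : forall v,
  (\rank (jacobian S v) < size S)%N <->
  (x1 v = 0 /\ y1 v = 0) \/ (fA v = 0 /\ fB v = 0).

(** The locus X1 = Y1 = 0 contributes [T1 :&: E1] and [T2 :&: E2]; the locus A = B = 0 contributes
    the other two vertices. *)
Lemma singular_points (V : {vspace 'rV[k]_(3 + 3)}) :
  singular_point S V <-> V \in vertices T1 T2 E1 E2.
Proof.
have [d11 d12 d21 d22] := square_dims dT1 dT2 E1E2_disjoint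
  T1E1_neq0 T1E2_neq0 T2E1_neq0 T2E2_neq0.
split.
- case=> dV VS Vsing; have V0 : V != 0%VS by rewrite -dimv_eq0 dV.
  pose v := vpick V; have vV : v \in V := memv_pick V.
  have v0 : v != 0 by rewrite vpick0.
  have vS : on_surface v by apply/S_surface/VS.
  have VE : V = <[v]>%VS.
    by apply/eqP; rewrite eq_sym eqEdim -memvE vV dim_vline v0 dV.
  have eqV (U : {vspace 'rV[k]_(3 + 3)}) : \dim U = 1%N -> v \in U -> V = U.
    by move=> dU vU; apply/eqP; rewrite eqEdim {1}VE -memvE vU dV dU.
  have := Vsing _ vV v0; move/rank_jacobian => [[vx vy]|[A0 B0]].
    have /orP[vF|vG] : onF v || onG v by apply: surface_onFG; rewrite // vx mul0r.
      by rewrite (eqV _ d11) ?inE ?eqxx // memv_cap memT1 memE1 vx vy eqxx vF.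
    by rewrite (eqV _ d22) ?inE ?eqxx ?orbT // memv_cap memT2 memE2 vx vy eqxx vG.
  (* A = B = 0 forces M = 0, hence X1 Y1 = 0 by the third equation, and [v] satisfies both [onF] and
     [onG]. *)
  have M0 : fM v = 0 by rewrite /fM A0 B0 !mulr0 addr0.
  have xy0 : x1 v * y1 v = 0.
    case: vS => _ _; rewrite M0 expr0n addr0 => /eqP.
    by rewrite mulf_eq0 expf_eq0 (negPf e0) => /eqP.
  case: vS; rewrite xy0 mulr0 !add0r => q0 R0 _.
  have [f1 f2 g1 g2] := AB_FG A0 B0 q0.
  have vF : onF v by rewrite /onF f1 f2 R0 eqxx.
  have vG : onG v by rewrite /onG g1 g2 R0 eqxx.
  move/eqP: xy0; rewrite mulf_eq0 => /orP[] v1.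
    by rewrite (eqV _ d21) ?inE ?eqxx ?orbT // memv_cap memT2 memE1 v1 vF vG.
  by rewrite (eqV _ d12) ?inE ?eqxx ?orbT // memv_cap memT1 memE2 v1 vF vG.
rewrite !inE => /or4P[] /eqP ->; split=> // v; rewrite memv_cap
  ?memT1 ?memT2 ?memE1 ?memE2 => /andP[/andP[/eqP h1 h2] /andP[/eqP h3 h4]].
- by apply/S_surface/onF_surface; rewrite // h1 mulr0.
- by move=> _; apply/rank_jacobian; left.
- by apply/S_surface/onF_surface; rewrite // h1 mulr0.
- move=> _; apply/rank_jacobian; right.
  move: h2 h4 => /and3P[/eqP f1 /eqP f2 _] /and3P[/eqP g1 /eqP g2 _].
  exact: FG_AB.
- by apply/S_surface/onG_surface; rewrite // h1 mul0r.
- move=> _; apply/rank_jacobian; right.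
  move: h2 h4 => /and3P[/eqP g1 /eqP g2 _] /and3P[/eqP f1 /eqP f2 _].
  exact: FG_AB.
- by apply/S_surface/onG_surface; rewrite // h1 mul0r.
- by move=> _; apply/rank_jacobian; left.
Qed.

End SurfacePoints.

(** * The quadrics and their Jacobian matrix *)

Lemma rank_lt_mulmx (k : fieldType) m n (J : 'M[k]_(m, n)) :
  (\rank J < m)%N <-> exists2 s : 'rV_m, s *m J = 0 & s != 0.
Proof.
have -> : (\rank J < m)%N = (kermx J != 0).
  by rewrite kermx_eq0 /row_free ltn_neqAle rank_leq_row andbT.
split=> [/rowV0Pn[s /sub_kermxP sJ s0]|[s sJ s0]]; first by exists s.
by apply/rowV0Pn; exists s => //; apply/sub_kermxP.
Qed.

Lemma sum3 (V : nmodType) (F : 'I_3 -> V) : \sum_i F i = F i1 + F i2 + F i3.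
Proof.
rewrite !big_ord_recl big_ord0 addr0 addrA.
by do ?[congr (_ + _)]; congr F; apply: val_inj.
Qed.

Section Sigma1.
Variables (k : closedFieldType) (char2 : 2%N \in [pchar k]).
Variables (a c d : 'I_3 -> k) (b1 b2 b3 b4 p q r t : k) (nc nd : 'I_3 -> k).
Hypotheses (a12 : a i1 != a i2) (a23 : a i2 = a i3).
Hypotheses (cE : forall i, c i = nc i ^+ 2) (dE : forall i, d i = nd i ^+ 2).
Hypotheses (b1E : b1 = (q * r) ^+ 2) (b2E : b2 = (p * t) ^+ 2).
Hypotheses (b3E : b3 = (q * t) ^+ 2) (b4E : b4 = (p * r) ^+ 2).
Let e := a i1 + a i2.

Let mchar2 : 2%N \in [pchar {mpoly k[3 + 3]}].
Proof. exact: (rmorph_pchar (mpolyC (3 + 3) (R := k)) char2). Qed.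

Definition formA : {mpoly k[3 + 3]} := q ^+ 2 *: X k i2 + p ^+ 2 *: Y k i2.
Definition formB : {mpoly k[3 + 3]} := t ^+ 2 *: X k i3 + r ^+ 2 *: Y k i3.
Definition formN : {mpoly k[3 + 3]} := \sum_i (nc i *: X k i + nd i *: Y k i).

Lemma quadric1E :
  quadric1 k = X k i1 * Y k i1 + X k i2 * Y k i2 + X k i3 * Y k i3.
Proof. exact: sum3. Qed.

(** In characteristic 2 the diagonal terms form N^2, the four mixed terms with coefficients b_i
    factor as A B, and [e] is a1 - a2. The same scalars make the diagonal part of [quadric3] the
    square of M. *)
Lemma quadric2E : quadric2 a c d b1 b2 b3 b4 =
  a i2 *: quadric1 k + e *: (X k i1 * Y k i1) + formN ^+ 2 + formA * formB.
Proof.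
rewrite /quadric2 /quadric1 /formN /formA /formB /e !sum3 -a23 !cE !dE.
by rewrite b1E b2E b3E b4E; char2_ring mchar2.
Qed.

Lemma quadric3E : quadric3 a b1 b2 b3 b4 =
  a i2 ^+ 2 *: quadric1 k + e ^+ 2 *: (X k i1 * Y k i1)
  + ((r * t) *: formA + (p * q) *: formB) ^+ 2.
Proof.
rewrite /quadric3 /quadric1 /formA /formB /e !sum3 -a23.
by rewrite b1E b2E b3E b4E; char2_ring mchar2.
Qed.

Lemma evalv_formA v : evalv formA v = fA p q v.
Proof. by rewrite /formA !evalvE. Qed.

Lemma evalv_formB v : evalv formB v = fB r t v.
Proof. by rewrite /formB !evalvE. Qed.

Lemma evalv_formN v : evalv formN v = fN nc nd v.
Proof. by rewrite /formN sum3 !evalvE. Qed.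

Lemma formN_homog : formN \is 1.-homog.
Proof.
rewrite /formN sum3.
by do ?[apply: dhomogD | apply: dhomogZ]; apply: var_homog1.
Qed.

Lemma Sigma1_surface v : common_zero (Sigma1 a c d b1 b2 b3 b4) v <->
  on_surface p q r t e nc nd v.
Proof.
have q1 : evalv (quadric1 k) v = x1 v * y1 v + fq v.
  by rewrite quadric1E !evalvE /fq addrA.
have xy : evalv (X k i1 * Y k i1) v = x1 v * y1 v by rewrite !evalvE.
have q2 : evalv (quadric2 a c d b1 b2 b3 b4) v =
    a i2 * (x1 v * y1 v + fq v) + (e * (x1 v * y1 v) + fR p q r t nc nd v).
  rewrite quadric2E 3!evalvD 2!evalvZ q1 xy evalvXn evalv_formN.
  by rewrite evalvM evalv_formA evalv_formB !addrA.
have q3 : evalv (quadric3 a b1 b2 b3 b4) v = a i2 ^+ 2 * (x1 v * y1 v + fq v)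
    + (e ^+ 2 * (x1 v * y1 v) + fM p q r t v ^+ 2).
  rewrite quadric3E 2!evalvD 2!evalvZ q1 xy evalvXn evalvD 2!evalvZ.
  by rewrite evalv_formA evalv_formB -addrA.
rewrite /common_zero /= q1 q2 q3 andbT; split=> [/and3P[/eqP h1 /eqP h2 /eqP h3]|].
  by move: h2 h3; rewrite h1 !mulr0 !add0r.
by move=> [-> -> ->]; rewrite !mulr0 !addr0 eqxx.
Qed.

Lemma evalv_deriv_var i j (v : 'rV[k]_(3 + 3)) : evalv ('X_i)^`M(j) v = (i == j)%:R :> k.
Proof.
rewrite mderivX /evalv mevalZ mnm1E; case: eqP => [->|_]; last by rewrite mul0r.
by rewrite mul1r mevalX big1 // => h _; rewrite mnmBE subnn expr0.
Qed.

Lemma evalv_derivD j f g (v : 'rV[k]_(3 + 3)) :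
  evalv (f + g)^`M(j) v = evalv f^`M(j) v + evalv g^`M(j) v.
Proof. by rewrite mderivD evalvD. Qed.

Lemma evalv_derivZ j z f (v : 'rV[k]_(3 + 3)) :
  evalv (z *: f)^`M(j) v = z * evalv f^`M(j) v.
Proof. by rewrite mderivZ evalvZ. Qed.

Lemma evalv_derivM j f g (v : 'rV[k]_(3 + 3)) :
  evalv (f * g)^`M(j) v = evalv f^`M(j) v * evalv g v + evalv f v * evalv g^`M(j) v.
Proof. by rewrite mderivM evalvD !evalvM. Qed.

(** This removes N and M from the Jacobian matrix. *)
Lemma evalv_deriv_sqr j f (v : 'rV[k]_(3 + 3)) : evalv (f ^+ 2)^`M(j) v = 0.
Proof. by rewrite expr2 evalv_derivM; char2_ring char2. Qed.

Let S := Sigma1 a c d b1 b2 b3 b4.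

(** The combination of rows is [m] times the differential of [quadric1], plus [n - m] times that of
    X1 Y1, plus [s2] times that of A B; the six equations are its components. *)
Lemma mul_jacobian (s : 'rV[k]_(size S)) v :
  let s1 := s 0 i1 in let s2 := s 0 i2 in let s3 := s 0 i3 in
  let m := s1 + a i2 * s2 + a i2 ^+ 2 * s3 in
  let n := m + e * s2 + e ^+ 2 * s3 in
  s *m jacobian S v = 0 <->
  [/\ n * y1 v = 0, n * x1 v = 0 &
    [/\ m * y2 v + s2 * q ^+ 2 * fB r t v = 0,
        m * x2 v + s2 * p ^+ 2 * fB r t v = 0,
        m * y3 v + s2 * t ^+ 2 * fA p q v = 0
      & m * x3 v + s2 * r ^+ 2 * fA p q v = 0]].
Proof.
move=> s1 s2 s3 m n.
have jE j : (s *m jacobian S v) 0 j =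
    m * evalv (quadric1 k)^`M(j) v + (e * s2 + e ^+ 2 * s3) *
      evalv (X k i1 * Y k i1)^`M(j) v
    + s2 * (evalv formA^`M(j) v * fB r t v + fA p q v * evalv formB^`M(j) v).
  have q2 : evalv (quadric2 a c d b1 b2 b3 b4)^`M(j) v =
      a i2 * evalv (quadric1 k)^`M(j) v + e * evalv (X k i1 * Y k i1)^`M(j) v
      + (evalv formA^`M(j) v * fB r t v + fA p q v * evalv formB^`M(j) v).
    rewrite quadric2E 3!evalv_derivD 2!evalv_derivZ evalv_deriv_sqr addr0.
    by rewrite (evalv_derivM _ formA) evalv_formA evalv_formB.
  have q3 : evalv (quadric3 a b1 b2 b3 b4)^`M(j) v =
      a i2 ^+ 2 * evalv (quadric1 k)^`M(j) v
      + e ^+ 2 * evalv (X k i1 * Y k i1)^`M(j) v.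
    by rewrite quadric3E 2!evalv_derivD 2!evalv_derivZ evalv_deriv_sqr addr0.
  rewrite mxE sum3 !mxE /= q2 q3 -/s1 -/s2 -/s3 /m; ring.
have dxy j : evalv (X k i1 * Y k i1)^`M(j) v =
    (lshift 3 i1 == j)%:R * y1 v + x1 v * (rshift 3 i1 == j)%:R.
  by rewrite evalv_derivM !evalv_deriv_var !evalv_var.
have dq j : evalv (quadric1 k)^`M(j) v =
    (lshift 3 i1 == j)%:R * y1 v + x1 v * (rshift 3 i1 == j)%:R
    + ((lshift 3 i2 == j)%:R * y2 v + x2 v * (rshift 3 i2 == j)%:R)
    + ((lshift 3 i3 == j)%:R * y3 v + x3 v * (rshift 3 i3 == j)%:R).
  by rewrite quadric1E 2!evalv_derivD !evalv_derivM !evalv_deriv_var !evalv_var.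
have dA j : evalv formA^`M(j) v =
    q ^+ 2 * (lshift 3 i2 == j)%:R + p ^+ 2 * (rshift 3 i2 == j)%:R.
  by rewrite evalv_derivD 2!evalv_derivZ !evalv_deriv_var.
have dB j : evalv formB^`M(j) v =
    t ^+ 2 * (lshift 3 i3 == j)%:R + r ^+ 2 * (rshift 3 i3 == j)%:R.
  by rewrite evalv_derivD 2!evalv_derivZ !evalv_deriv_var.
have J1 : (s *m jacobian S v) 0 (lshift 3 i1) = n * y1 v.
  by rewrite jE dxy dq dA dB !(eq_lshift, eq_rlshift) /= /n; ring.
have J2 : (s *m jacobian S v) 0 (rshift 3 i1) = n * x1 v.
  by rewrite jE dxy dq dA dB !(eq_lrshift, eq_rshift) /= /n; ring.
have J3 : (s *m jacobian S v) 0 (lshift 3 i2) = m * y2 v + s2 * q ^+ 2 * fB r t v.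
  by rewrite jE dxy dq dA dB !(eq_lshift, eq_rlshift) /=; ring.
have J4 : (s *m jacobian S v) 0 (rshift 3 i2) = m * x2 v + s2 * p ^+ 2 * fB r t v.
  by rewrite jE dxy dq dA dB !(eq_lrshift, eq_rshift) /=; ring.
have J5 : (s *m jacobian S v) 0 (lshift 3 i3) = m * y3 v + s2 * t ^+ 2 * fA p q v.
  by rewrite jE dxy dq dA dB !(eq_lshift, eq_rlshift) /=; ring.
have J6 : (s *m jacobian S v) 0 (rshift 3 i3) = m * x3 v + s2 * r ^+ 2 * fA p q v.
  by rewrite jE dxy dq dA dB !(eq_lrshift, eq_rshift) /=; ring.
rewrite -J1 -J2 -J3 -J4 -J5 -J6; split=> [->|[h1 h2 [h3 h4 h5 h6]]].
  by rewrite !mxE.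
exact: coord_eq0.
Qed.

Hypothesis pq0 : (p != 0) || (q != 0).
Hypothesis rt0 : (r != 0) || (t != 0).

(** For a relation between the rows, [n != 0] gives X1 = Y1 = 0. If [n = 0], the last four
    components of [mul_jacobian] give A = B = 0, whether or not [m] vanishes. *)
Lemma rank_jacobian_Sigma1 v : (\rank (jacobian S v) < size S)%N <->
  (x1 v = 0 /\ y1 v = 0) \/ (fA p q v = 0 /\ fB r t v = 0).
Proof.
have e0 : e != 0 by rewrite char2_addr_eq0.
rewrite rank_lt_mulmx; split=> [[s /mul_jacobian] /=|].
  set m := s 0 i1 + _ + _; set n := m + _ + _.
  move=> [ny nx [h1 h2 h3 h4]] s0.
  have [n0|n0] := eqVneq n 0; last first.
    by left; split; apply: (mulfI n0); rewrite mulr0.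
  right; have [m0|m0] := eqVneq m 0; last first.
    split; apply: (mulfI m0); rewrite mulr0.
      transitivity (q ^+ 2 * (m * x2 v + s 0 i2 * p ^+ 2 * fB r t v)
        + p ^+ 2 * (m * y2 v + s 0 i2 * q ^+ 2 * fB r t v)).
        by rewrite /fA; char2_ring char2.
      by rewrite h1 h2 !mulr0 addr0.
    transitivity (t ^+ 2 * (m * x3 v + s 0 i2 * r ^+ 2 * fA p q v)
        + r ^+ 2 * (m * y3 v + s 0 i2 * t ^+ 2 * fA p q v)).
      by rewrite /fB; char2_ring char2.
    by rewrite h3 h4 !mulr0 addr0.
  (* With [m = n = 0], a zero [s2] would successively make [s3] and [s1] vanish. *)
  have s2 : s 0 i2 != 0.
    apply: contraNneq s0 => s2; move: n0; rewrite /n m0 s2 mulr0 addr0 add0r.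
    move/eqP; rewrite mulf_eq0 expf_eq0 (negPf e0) /= => /eqP s3.
    move: m0; rewrite /m s2 s3 !mulr0 !addr0 => s1.
    apply/eqP/rowP => -[[|[|[|//]]] lt3]; rewrite [RHS]mxE.
    - by rewrite -[RHS]s1; congr (s _ _); apply: val_inj.
    - by rewrite -[RHS]s2; congr (s _ _); apply: val_inj.
    - by rewrite -[RHS]s3; congr (s _ _); apply: val_inj.
  have sq x y : (x != 0) || (y != 0) ->
      (s 0 i2 * x ^+ 2 != 0) || (s 0 i2 * y ^+ 2 != 0).
    by case/orP=> h; apply/orP; [left | right]; rewrite mulf_neq0 ?expf_neq0.
  move: h1 h2 h3 h4; rewrite m0 !mul0r !add0r => h1 h2 h3 h4.
  by split; [apply: (cancel_pair (sq _ _ rt0)) | apply: (cancel_pair (sq _ _ pq0))].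
pose row3 x y : 'rV[k]_(size S) := \row_i [:: x; y; 1]`_i.
have row3_neq0 x y : row3 x y != 0.
  apply/negP => /eqP/rowP/(_ i3); rewrite !mxE => /eqP; rewrite /= oner_eq0 //.
case=> [[vx vy]|[A0 B0]].
  (* This is the combination e^2 X1 Y1 + M^2 of the quadrics: it has [m = 0] and [s2 = 0]. *)
  exists (row3 (a i2 ^+ 2) 0); rewrite ?row3_neq0 //.
  apply/mul_jacobian; rewrite !mxE /= vx vy !mulr0 !mul0r mulr1 !addr0.
  by rewrite addrr_pchar2 // !mul0r.
(* These coefficients are chosen so that [m = n = 0]; the combination is e (N^2 + A B) + M^2. *)
exists (row3 (a i1 * a i2) e); rewrite ?row3_neq0 //.
apply/mul_jacobian; rewrite !mxE /= A0 B0 !mulr0 !mulr1 !addr0.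
have -> : a i1 * a i2 + a i2 * e + a i2 ^+ 2 = 0 by rewrite /e; char2_ring char2.
by rewrite add0r -expr2 addrr_pchar2 // !mul0r.
Qed.

(** * The four planes and their double lines *)

Hypotheses (nc1 : nc i1 != 0) (nd1 : nd i1 != 0).
Hypothesis nw0 : nc i2 * (p ^+ 2 * r * t) + nd i2 * (q ^+ 2 * r * t)
  + nc i3 * (p * q * r ^+ 2) + nd i3 * (p * q * t ^+ 2) != 0.

Let sqrt_b1 : ksqrt b1 = q * r. Proof. exact: ksqrt_unique. Qed.
Let sqrt_b2 : ksqrt b2 = p * t. Proof. exact: ksqrt_unique. Qed.
Let sqrt_b3 : ksqrt b3 = q * t. Proof. exact: ksqrt_unique. Qed.
Let sqrt_b4 : ksqrt b4 = p * r. Proof. exact: ksqrt_unique. Qed.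

(** Here [z] is X1 and [z'] is Y1, so [nc1] supplies the nonzero coefficient of [z] in N; for [E1]
    the two are exchanged and [nd1] is used. *)
Lemma Theta1_double_line : exists L, plane_cuts_double_line S (plane_Theta1 b1 b2) L /\
  forall v, (v \in L) = (y1 v == 0) && onF p q r t nc nd v.
Proof.
have [|v|L [cutL memL]] := plane_section_double_line char2
  (z := lshift 3 i1) (z' := rshift 3 i1) (x2 := lshift 3 i2) (x3 := lshift 3 i3)
  (y2 := rshift 3 i2) (y3 := rshift 3 i3)
  _ (a i2) e (a i2 ^+ 2) (e ^+ 2) formN_homog nc1 _ (ptqr nw0).
- by move=> v *; apply: coord_eq0.
- rewrite evalv_formN /fN /x1 /x2 /x3 /y1 /y2 /y3 => -> -> -> -> ->.
  by rewrite !mulr0 !addr0.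
exists L; split=> [|v].
  move: cutL; rewrite /plane_Theta1 sqrt_b1 sqrt_b2; congr plane_cuts_double_line.
  by rewrite /S /Sigma1 quadric2E quadric3E quadric1E.
by rewrite memL /onF /fR evalv_formA evalv_formB evalv_formN !evalvE.
Qed.

Lemma E1_double_line : exists L, plane_cuts_double_line S (plane_E1 b1 b2) L /\
  forall v, (v \in L) = (x1 v == 0) && onF p q r t nc nd v.
Proof.
have [|v|L [cutL memL]] := plane_section_double_line char2
  (z := rshift 3 i1) (z' := lshift 3 i1) (x2 := lshift 3 i2) (x3 := lshift 3 i3)
  (y2 := rshift 3 i2) (y3 := rshift 3 i3)
  _ (a i2) e (a i2 ^+ 2) (e ^+ 2) formN_homog nd1 _ (ptqr nw0).
- by move=> v *; apply: coord_eq0.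
- rewrite evalv_formN /fN /x1 /x2 /x3 /y1 /y2 /y3 => -> -> -> -> ->.
  by rewrite !mulr0 add0r !addr0.
exists L; split=> [|v].
  move: cutL; rewrite /plane_E1 sqrt_b1 sqrt_b2; congr plane_cuts_double_line.
  by rewrite /S /Sigma1 quadric2E quadric3E quadric1E [X k i1 * _]mulrC.
by rewrite memL /onF /fR evalv_formA evalv_formB evalv_formN !evalvE.
Qed.

(* Exchanging [X3] with [Y3] and [r] with [t] reduces the planes of [Theta2] and
   [E2] to those of [E1] and [Theta1]. *)
Lemma Theta2_double_line : exists L, plane_cuts_double_line S (plane_Theta2 b3 b4) L /\
  forall v, (v \in L) = (x1 v == 0) && onG p q r t nc nd v.
Proof.
have qtpr : (p * r != 0) || (q * t != 0) := prqt nw0.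
have [|v|L [cutL memL]] := plane_section_double_line char2
  (z := rshift 3 i1) (z' := lshift 3 i1) (x2 := lshift 3 i2) (x3 := rshift 3 i3)
  (y2 := rshift 3 i2) (y3 := lshift 3 i3)
  _ (a i2) e (a i2 ^+ 2) (e ^+ 2) formN_homog nd1 _ qtpr.
- by move=> v *; apply: coord_eq0.
- rewrite evalv_formN /fN /x1 /x2 /x3 /y1 /y2 /y3 => -> -> -> -> ->.
  by rewrite !mulr0 add0r !addr0.
exists L; split=> [|v].
  move: cutL; rewrite /plane_Theta2 sqrt_b3 sqrt_b4 [(p * r) *: _ + _]addrC.
  congr plane_cuts_double_line.
  rewrite /S /Sigma1 quadric2E quadric3E quadric1E /formA /formB /X /Y.
  by congr [:: _; _; _]; char2_ring mchar2.
rewrite memL /onG /fR evalv_formN !evalvE [p * r * _ + _]addrC.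
by rewrite [r ^+ 2 * _ + _]addrC.
Qed.

Lemma E2_double_line : exists L, plane_cuts_double_line S (plane_E2 b3 b4) L /\
  forall v, (v \in L) = (y1 v == 0) && onG p q r t nc nd v.
Proof.
have qtpr : (p * r != 0) || (q * t != 0) := prqt nw0.
have [|v|L [cutL memL]] := plane_section_double_line char2
  (z := lshift 3 i1) (z' := rshift 3 i1) (x2 := lshift 3 i2) (x3 := rshift 3 i3)
  (y2 := rshift 3 i2) (y3 := lshift 3 i3)
  _ (a i2) e (a i2 ^+ 2) (e ^+ 2) formN_homog nc1 _ qtpr.
- by move=> v *; apply: coord_eq0.
- rewrite evalv_formN /fN /x1 /x2 /x3 /y1 /y2 /y3 => -> -> -> -> ->.
  by rewrite !mulr0 !addr0.
exists L; split=> [|v].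
  move: cutL; rewrite /plane_E2 sqrt_b3 sqrt_b4 [(p * r) *: _ + _]addrC.
  congr plane_cuts_double_line.
  rewrite /S /Sigma1 quadric2E quadric3E quadric1E /formA /formB /X /Y.
  by congr [:: _; _; _]; char2_ring mchar2.
rewrite memL /onG /fR evalv_formN !evalvE [p * r * _ + _]addrC.
by rewrite [r ^+ 2 * _ + _]addrC.
Qed.

End Sigma1.

Theorem theorem5p6 (k : closedFieldType) (char2 : 2%N \in [pchar k])
  (a c d alpha beta gamma delta : 'I_3 -> k) (b1 b2 b3 b4 : k)
  (a12 : a i1 != a i2) (a23 : a i2 = a i3)
  (det1 : forall i : 'I_3, alpha i * delta i + beta i * gamma i = 1)
  (b1E : b1 = beta i3 * gamma i2) (b2E : b2 = alpha i2 * delta i3)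
  (b3E : b3 = gamma i2 * delta i3) (b4E : b4 = alpha i2 * beta i3)
  (cd1 : c i1 * d i1 != 0)
  (nonsing : b2 * b4 * c i2 + b1 * b4 * c i3
             + b1 * b3 * d i2 + b2 * b3 * d i3 != 0) :
  let S := Sigma1 a c d b1 b2 b3 b4 in
  exists T1 T2 E1 E2 : {vspace 'rV[k]_(3 + 3)},
    let lines := [:: T1; T2; E1; E2] in
    (* (1) *)
    ([/\ plane_cuts_double_line S (plane_Theta1 b1 b2) T1,
         plane_cuts_double_line S (plane_Theta2 b3 b4) T2,
         plane_cuts_double_line S (plane_E1 b1 b2) E1
       & plane_cuts_double_line S (plane_E2 b3 b4) E2] /\
     uniq lines /\
     (forall L : {vspace 'rV[k]_(3 + 3)},
        (\dim L = 2)%N /\ contained L S <-> L \in lines) /\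
     (T1 :&: T2 = 0)%VS /\ (E1 :&: E2 = 0)%VS /\
     [/\ (\dim (T1 :&: E1) = 1)%N, (\dim (T1 :&: E2) = 1)%N,
         (\dim (T2 :&: E1) = 1)%N & (\dim (T2 :&: E2) = 1)%N]) /\
    (* (2) *)
    (exists s : seq {vspace 'rV[k]_(3 + 3)},
       [/\ uniq s, size s = 4%N,
           forall p : {vspace 'rV[k]_(3 + 3)}, singular_point S p <-> p \in s
         & forall p : {vspace 'rV[k]_(3 + 3)},
             p \in s <->
             (\dim p = 1)%N /\
             exists L M : {vspace 'rV[k]_(3 + 3)},
               [/\ L \in lines, M \in lines, L != M & (p <= L :&: M)%VS]]).
Proof.
move=> S.
(* With these roots, the square roots of b1, ..., b4 become the monomials q r, p t, q t, p r. *)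
pose p := ksqrt (alpha i2); pose q := ksqrt (gamma i2).
pose r := ksqrt (beta i3); pose t := ksqrt (delta i3).
pose nc i := ksqrt (c i); pose nd i := ksqrt (d i).
have cE i : c i = nc i ^+ 2 by rewrite ksqrtK.
have dE i : d i = nd i ^+ 2 by rewrite ksqrtK.
have {}b1E : b1 = (q * r) ^+ 2 by rewrite exprMn !ksqrtK mulrC.
have {}b2E : b2 = (p * t) ^+ 2 by rewrite exprMn !ksqrtK.
have {}b3E : b3 = (q * t) ^+ 2 by rewrite exprMn !ksqrtK.
have {}b4E : b4 = (p * r) ^+ 2 by rewrite exprMn !ksqrtK.
(* By additivity of squares, the square of this expression is the one in [nonsing]. *)
have nw0 : nc i2 * (p ^+ 2 * r * t) + nd i2 * (q ^+ 2 * r * t)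
    + nc i3 * (p * q * r ^+ 2) + nd i3 * (p * q * t ^+ 2) != 0.
  rewrite -sqrf_eq0; apply: contraNneq nonsing => nw.
  rewrite -[X in _ == X]nw !cE !dE b1E b2E b3E b4E; apply/eqP; char2_ring char2.
have pq0 : (p != 0) || (q != 0).
  by case/orP: (ptqr nw0); rewrite mulf_eq0 negb_or => /andP[-> _]; rewrite ?orbT.
have rt0 : (r != 0) || (t != 0).
  by case/orP: (ptqr nw0); rewrite mulf_eq0 negb_or => /andP[_ ->]; rewrite ?orbT.
have [nc1 nd1] : nc i1 != 0 /\ nd i1 != 0.
  by move: cd1; rewrite cE dE mulf_eq0 !sqrf_eq0 negb_or => /andP[].
have e0 : a i1 + a i2 != 0 by rewrite char2_addr_eq0.
have [T1 [cutT1 memT1]] := Theta1_double_line char2 a23 cE dE b1E b2E b3E b4E nc1 nw0.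
have [E1 [cutE1 memE1]] := E1_double_line char2 a23 cE dE b1E b2E b3E b4E nd1 nw0.
have [T2 [cutT2 memT2]] := Theta2_double_line char2 a23 cE dE b1E b2E b3E b4E nd1 nw0.
have [E2 [cutE2 memE2]] := E2_double_line char2 a23 cE dE b1E b2E b3E b4E nc1 nw0.
have dT1 : \dim T1 = 2%N by case: cutT1 => _ [].
have dT2 : \dim T2 = 2%N by case: cutT2 => _ [].
have dE1 : \dim E1 = 2%N by case: cutE1 => _ [].
have dE2 : \dim E2 = 2%N by case: cutE2 => _ [].
have Ssurf := Sigma1_surface char2 a23 cE dE b1E b2E b3E b4E.
have rkJ := rank_jacobian_Sigma1 char2 a12 a23 cE dE b1E b2E b3E b4E pq0 rt0.
have TT0 := T1T2_disjoint char2 nw0 memT1 memT2.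
have EE0 := E1E2_disjoint char2 nw0 memE1 memE2.
have TE11 := T1E1_neq0 dT1 memT1 memE1.
have TE12 := T1E2_neq0 char2 nw0 dT1 memT1 memE2.
have TE21 := T2E1_neq0 char2 nw0 dT2 memT2 memE1.
have TE22 := T2E2_neq0 dT2 memT2 memE2.
exists T1, T2, E1, E2 => lines; split.
  split; first by [].
  split; first exact: square_uniq.
  split; first exact: (lines_on_surface char2 e0 nw0 Ssurf).
  do 2![split=> //].
  exact: square_dims.
exists (vertices T1 T2 E1 E2); split=> //.
- exact: vertices_uniq.
- exact: (singular_points char2 e0 nw0 Ssurf).
- exact: vertices_meet.
Qed.
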